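(* Let $E = \left(\bigoplus_{n=1}^\infty \ell^\infty(n)\right)_{\ell^1}$. If $T$ is a bounded linear operator on $E$ such that $T \notin \mathcal{G}^i_{\ell^1}(E)$, then $1_E$ factors through $T$, i.e., there exist bounded linear operators $A, B \in L(E)$ with $1_E = ATB$. Consequently, $\mathcal{G}^i_{\ell^1}(E)$ is the unique maximal ideal of $L(E)$.
   Context: For Banach spaces $X, Y$, $L(X,Y)$ is the space of bounded linear operators from $X$ to $Y$ with the operator norm, $L(X) = L(X,X)$, and $1_X$ is the identity operator on $X$. $\ell^\infty(n)$ is the $n$-dimensional scalar space with the maximum norm. $\left(\bigoplus_{n=1}^\infty \ell^\infty(n)\right)_{\ell^1}$ is the Banach space of all sequences $x = (x_n)$ with $x_n \in \ell^\infty(n)$ and $\|x\| = \sum_n \|x_n\| < \infty$. $\ell^1 = \ell^1(\mathbb{N})$ and $\ell^\infty = \ell^\infty(\mathbb{N})$. Let $\mathcal{G}_{\ell^1}(X,Y) = \{T \in L(X,Y) : T = SR \text{ for some } R \in L(X,\ell^1),\ S \in L(\ell^1,Y)\}$. An embedding is a bounded linear operator that is an isomorphism onto its (closed) range. For a Banach space $X$, $\mathcal{G}^i_{\ell^1}(X)$ is the set of all $T \in L(X)$ such that there exists an embedding $\theta : X \to \ell^\infty$ with $\theta T \in \overline{\mathcal{G}_{\ell^1}(X,\ell^\infty)}$, the closure being taken in the operator norm. A maximal ideal of $L(E)$ is a maximal element, with respect to inclusion, among the proper two-sided ideals of $L(E)$. *)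

(* Defs.v *)
From HB Require Import structures.
From mathcomp Require Import all_boot all_order all_algebra.
From mathcomp Require Import all_classical all_reals all_analysis.
From mathcomp Require Import complex.
Import Order.TTheory GRing.Theory Num.Theory.
Import numFieldNormedType.Exports.
Set Implicit Arguments.
Unset Strict Implicit.
Unset Printing Implicit Defensive.
Local Open Scope classical_set_scope.
Local Open Scope ring_scope.

Variant scalar_kind := RealScalars | ComplexScalars.

(* As in [normedModType], norms of spaces over [R[i]] take their values in the
   nonnegative elements of [R[i]]; the order of [R[i]] is the partial order for
   which [x <= y] means that [y - x] is a nonnegative real. *)
Definition scalar_field (k : scalar_kind) (R : realType) : numFieldType :=
  match k with RealScalars => R | ComplexScalars => complex R end.

Section numfield_limits.
Variable K : numFieldType.

Lemma ge0_closed (x : K) :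
  (forall d : K, 0 < d -> exists2 y : K, 0 <= y & `|x - y| <= d) -> 0 <= x.
Proof.
move=> H; suff : `|x| - x == 0 by rewrite subr_eq0 => /eqP <-.
rewrite -normr_le0; apply/ler_addgt0Pr => d d0; rewrite add0r.
have [y y0 xy] := H (d / 2) (divr_gt0 d0 (ltr0Sn _ 1)).
rewrite (splitr d) -(subrKA y) (le_trans (ler_normD _ _))//.
rewrite lerD//; last by rewrite distrC.
by rewrite -{1}(ger0_norm y0) (le_trans (ler_dist_dist _ _)).
Qed.

Lemma cvgn_le (u : K^nat) l M : u @ \oo --> l ->
  (\forall n \near \oo, u n <= M) -> l <= M.
Proof.
move=> /cvgrPdist_le ul uM; rewrite -subr_ge0; apply: ge0_closed => d d0.
have [n [unM lun]] := filter_ex (filterI uM (ul d d0)).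
exists (M - u n); first by rewrite subr_ge0.
by rewrite opprB addrC addrA subrK distrC.
Qed.

Lemma nondecreasing_le_cvgn (u : K^nat) l : nondecreasing_seq u ->
  u @ \oo --> l -> forall n, u n <= l.
Proof.
move=> ndu ul n; rewrite -lerN2.
apply: (@cvgn_le (fun n => - u n)); first exact: cvgN.
by exists n => // m /= nm; rewrite lerN2 ndu.
Qed.

Lemma cauchy_lipschitz (V W : normedModType K) (f : V -> W)
    (F : set_system V) : ProperFilter F ->
  (forall x y, `|f x - f y| <= `|x - y|) -> cauchy F -> cauchy (f @ F).
Proof.
move=> FF fL /cauchy_ballP cF; apply/cauchy_ballP => e e0.
have [[A B]/= [FA FB] AB] := cF e e0.
exists (f @` A, f @` B) => /=.
  by split; [apply: filterS FA | apply: filterS FB] => x; exists x.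
move=> [_ _] [/= [x Ax <-] [y By <-]]; have := AB (x, y) (conj Ax By).
rewrite -!ball_normE /=; exact: le_lt_trans.
Qed.

End numfield_limits.

Lemma complex_norm_le (R : realType) (z : complex R) :
  `|z| <= `|complex.Re z|%:C%C + `|complex.Im z|%:C%C.
Proof.
rewrite [X in `|X| <= _]complexE (le_trans (ler_normD _ _))//.
rewrite normrM complexiE normCi mul1r.
by rewrite lerD// normc_def/= expr0n addr0 sqrtr_sqr.
Qed.

Section scalar_theory.
Variables (k : scalar_kind) (R : realType).
Local Notation K := (scalar_field k R).

Lemma scalar_isLub (A : set K) : A !=set0 -> has_ubound A ->
  (forall x, A x -> 0 <= x) -> exists s, isLub A s.
Proof.
case: k A => A [x0 Ax0] [M AM] A0.
  have hA : has_sup (A : set R) by split; [exists x0 | exists M].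
  exists (sup (A : set R)); split; first exact: (sup_upper_bound hA).
  by move=> b Ab; apply: (@ge_sup R); [exists x0 | exact: Ab].
pose B := [set x : R | A x%:C%C].
have AE z : A z -> z = (complex.Re z)%:C%C.
  by move=> /A0 z0; rewrite RRe_real// ger0_real.
have leC b : ubound A b -> b = (complex.Re b)%:C%C.
  move=> /(_ _ Ax0) xb; rewrite RRe_real// ger0_real//.
  by rewrite (le_trans (A0 _ Ax0)).
have hB : has_sup B.
  split; first by exists (complex.Re x0); rewrite /B/= -AE.
  exists (complex.Re M) => y /AM; rewrite {1}(leC M AM).
  by rewrite lecR.
exists (sup B)%:C%C; split.
  move=> z Az; rewrite (AE _ Az) lecR; apply: (sup_upper_bound hB).
  by rewrite /B/= -AE.
move=> b Ab; rewrite (leC b Ab) lecR; apply: ge_sup; first by case: hB.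
by move=> y By; have := Ab _ By; rewrite {1}(leC b Ab) lecR.
Qed.

Lemma scalar_supremum (A : set K) : A !=set0 -> has_ubound A ->
  (forall x, A x -> 0 <= x) -> isLub A (supremum 0 A).
Proof.
move=> A0 hA Age0; have /set0P/negPf An0 := A0; rewrite /supremum An0.
have [s [sA As]] := scalar_isLub A0 hA Age0.
by case: xgetP => [_ -> //|/(_ s)[]].
Qed.

Lemma scalar_nondecreasing_cvgn (u : K^nat) : (forall n, 0 <= u n) ->
  nondecreasing_seq u -> has_ubound (range u) -> cvgn u.
Proof.
move=> u0 ndu hu; have [||s [us su]] := scalar_isLub _ hu.
- by exists (u 0), 0.
- by move=> _ [n _ <-].
apply/cvg_ex; exists s; apply/cvgrPdist_le => e e0.
have us' n : u n <= s by apply: us; exists n.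
have [N uN] : exists N, s - e <= u N.
  apply: contrapT => /forallNP h.
  suff : s <= s - e by rewrite lerDl oppr_ge0 => /le_gtF; rewrite e0.
  apply: su => _ [n _ <-]; have := h n => /negP.
  have uR : u n \is Num.real by rewrite ger0_real.
  have sR : s \is Num.real by rewrite ger0_real// (le_trans (u0 0)).
  by rewrite -real_ltNge ?rpredB ?(gtr0_real e0)// => /ltW.
exists N => // m /= Nm; rewrite ger0_norm ?subr_ge0//.
by rewrite lerBlDl -lerBlDr (le_trans uN)// ndu.
Qed.

Lemma scalar_complete (F : set_system K) :
  ProperFilter F -> cauchy F -> cvg F.
Proof.
case: k F => F; first exact: R_complete.
move=> FF /cauchy_ballP cF.
have cauchy_part (f : complex R -> R) :
    (forall x y, `|f x - f y|%:C%C <= `|x - y|) -> cvg (f @ F).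
  move=> fL; apply: (@R_complete _ _ (fmap_proper_filter f FF)).
  apply/cauchy_ballP => e e0.
  have e0C : 0 < e%:C%C :> complex R by rewrite ltcR.
  have [[A B]/= [FA FB] AB] := cF _ e0C.
  exists (f @` A, f @` B) => /=.
    by split; [apply: filterS FA | apply: filterS FB] => x; exists x.
  move=> [_ _] [/= [x Ax <-] [y By <-]]; have := AB (x, y) (conj Ax By).
  rewrite -!ball_normE /= -ltcR; exact/le_lt_trans/fL.
have /cvg_ex[/= a Fa] : cvg ((@complex.Re R : complex R -> R) @ F).
  apply: cauchy_part => x y.
  by rewrite (_ : _ - _ = complex.Re (x - y)) ?normc_ge_Re//; case: x y => ? ? [].
have /cvg_ex[/= b Fb] : cvg ((@complex.Im R : complex R -> R) @ F).
  apply: cauchy_part => x y.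
  rewrite (_ : _ - _ = - complex.Re ((x - y) * 'i%C)).
    by rewrite normrN (le_trans (normc_ge_Re _))// normrM complexiE normCi mulr1.
  by rewrite ReiNIm opprK; case: x y => ? ? [].
apply: (@cvgP (scalar_field ComplexScalars R) _ (a +i* b)%C).
apply/cvgrPdist_le => e e0.
have eE : e = (complex.Re e)%:C%C by rewrite RRe_real// gtr0_real.
have e2 : 0 < complex.Re e / 2 by rewrite divr_gt0// -ltcR -eE.
move/cvgrPdist_le : Fa => /(_ _ e2) Fa.
move/cvgrPdist_le : Fb => /(_ _ e2) Fb.
apply: filterS (filterI Fa Fb) => -[x y]/= [ax yb].
rewrite eE (splitr (complex.Re e)) rmorphD/=.
apply: le_trans (complex_norm_le _) _.
by apply: lerD; rewrite lecR.
Qed.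

End scalar_theory.

#[non_forgetful_inheritance]
HB.instance Definition _ (k : scalar_kind) (R : realType) :=
  Uniform_isComplete.Build (Num.NumField.sort (scalar_field k R))
    (@scalar_complete k R).

HB.instance Definition _ (k : scalar_kind) (R : realType) (n : nat) :=
  Complete.on 'rV[scalar_field k R]_n.

Section l1_sum.
Variables (k : scalar_kind) (R : realType).
Local Notation K := (scalar_field k R).
Variable X : nat -> completeNormedModType K.

Definition summable_seq (x : forall n, X n) : Prop :=
  cvgn (series (fun n => `|x n|)).

Lemma nondecreasing_normed_series (x : forall n, X n) :
  nondecreasing_seq (series (fun n => `|x n|)).
Proof. by apply/nondecreasing_seqP => n; rewrite seriesSr lerDl. Qed.

Lemma summable_seqP (x : forall n, X n) :
  summable_seq x <-> exists M, forall n, series (fun n => `|x n|) n <= M.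
Proof.
split=> [/cvg_ex[/= l xl]|[M xM]].
  by exists l; exact: nondecreasing_le_cvgn (nondecreasing_normed_series x) xl.
apply: scalar_nondecreasing_cvgn; last by exists M => _ [n _ <-].
  by move=> n; apply: sumr_ge0.
exact: nondecreasing_normed_series.
Qed.

Record l1sum := L1sum {
  l1sum_fun :> forall n, X n;
  l1sumP : summable_seq l1sum_fun
}.

Lemma l1sum_eq (x y : l1sum) : (forall n, x n = y n) -> x = y.
Proof.
case: x y => [x xP] [y yP] /= xy.
have exy : x = y by apply: functional_extensionality_dep.
by rewrite exy in xP *; rewrite (Prop_irrelevance xP yP).
Qed.

HB.instance Definition _ := gen_eqMixin l1sum.
HB.instance Definition _ := gen_choiceMixin l1sum.

Definition l1sum_norm (x : l1sum) : K := limn (series (fun n => `|x n|)).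

Lemma l1sum_norm_ge (x : l1sum) n : series (fun n => `|x n|) n <= l1sum_norm x.
Proof.
apply: nondecreasing_le_cvgn; first exact: nondecreasing_normed_series.
exact: l1sumP.
Qed.

Lemma l1sum_norm_le (x : l1sum) M :
  (forall n, series (fun n => `|x n|) n <= M) -> l1sum_norm x <= M.
Proof. 
move=> xM; apply: (@cvgn_le _ (series (fun n => `|x n|))); first exact: l1sumP.
by exists 0.
 Qed.

Lemma l1sum_coord_le (x : l1sum) n : `|x n| <= l1sum_norm x.
Proof.
apply: le_trans (l1sum_norm_ge x n.+1).
by rewrite seriesSr lerDr sumr_ge0.
Qed.

Lemma l1sum_zero_subproof : summable_seq (fun n => 0 : X n).
Proof.
by apply/summable_seqP; exists 0 => n; rewrite /series/= big1// => i _;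
  rewrite normr0.
Qed.

Lemma l1sum_opp_subproof (x : l1sum) : summable_seq (fun n => - x n).
Proof.
apply/summable_seqP; exists (l1sum_norm x) => n.
by rewrite /series/= (eq_bigr _ (fun i _ => normrN (x i))) l1sum_norm_ge.
Qed.

Lemma l1sum_addD (x y : l1sum) n :
  series (fun n => `|x n + y n|) n <= l1sum_norm x + l1sum_norm y.
Proof.
apply: le_trans (lerD (l1sum_norm_ge x n) (l1sum_norm_ge y n)).
by rewrite /series/= -big_split ler_sum// => i _; exact: ler_normD.
Qed.

Lemma l1sum_add_subproof (x y : l1sum) : summable_seq (fun n => x n + y n).
Proof. by apply/summable_seqP; eexists => n; exact: l1sum_addD. Qed.

Lemma l1sum_scaleE (a : K) (x : l1sum) :
  series (fun n => `|a *: x n|) = (fun n => `|a| * series (fun n => `|x n|) n).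
Proof.
apply/funext => n; rewrite /series/= mulr_sumr.
by apply: eq_bigr => i _; rewrite normrZ.
Qed.

Lemma l1sum_scale_subproof (a : K) (x : l1sum) :
  summable_seq (fun n => a *: x n).
Proof.
rewrite /summable_seq l1sum_scaleE.
by apply: is_cvgM; [exact: is_cvg_cst|exact: l1sumP].
Qed.

Definition l1sum_zero := L1sum l1sum_zero_subproof.
Definition l1sum_opp x := L1sum (@l1sum_opp_subproof x).
Definition l1sum_add x y := L1sum (@l1sum_add_subproof x y).
Definition l1sum_scale a x := L1sum (@l1sum_scale_subproof a x).

Fact l1sum_addA : associative l1sum_add.
Proof. by move=> x y z; apply: l1sum_eq => n; exact: addrA. Qed.
Fact l1sum_addC : commutative l1sum_add.
Proof. by move=> x y; apply: l1sum_eq => n; exact: addrC. Qed.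
Fact l1sum_add0 : left_id l1sum_zero l1sum_add.
Proof. by move=> x; apply: l1sum_eq => n; exact: add0r. Qed.
Fact l1sum_addN : left_inverse l1sum_zero l1sum_opp l1sum_add.
Proof. by move=> x; apply: l1sum_eq => n; exact: addNr. Qed.

HB.instance Definition _ := GRing.isZmodule.Build l1sum
  l1sum_addA l1sum_addC l1sum_add0 l1sum_addN.

Fact l1sum_scaleA a b (x : l1sum) :
  l1sum_scale a (l1sum_scale b x) = l1sum_scale (a * b) x.
Proof. by apply: l1sum_eq => n; exact: scalerA. Qed.
Fact l1sum_scale1 : left_id 1 l1sum_scale.
Proof. by move=> x; apply: l1sum_eq => n; exact: scale1r. Qed.
Fact l1sum_scaleDr : right_distributive l1sum_scale +%R.
Proof. by move=> a x y; apply: l1sum_eq => n; exact: scalerDr. Qed.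
Fact l1sum_scaleDl (x : l1sum) : {morph l1sum_scale^~ x : a b / a + b}.
Proof. by move=> a b; apply: l1sum_eq => n; exact: scalerDl. Qed.

HB.instance Definition _ := GRing.Zmodule_isLmodule.Build K l1sum
  l1sum_scaleA l1sum_scale1 l1sum_scaleDr l1sum_scaleDl.

Fact l1sum_normD (x y : l1sum) :
  l1sum_norm (x + y) <= l1sum_norm x + l1sum_norm y.
Proof. by apply: l1sum_norm_le => n; exact: l1sum_addD. Qed.

Fact l1sum_normZ a (x : l1sum) : l1sum_norm (a *: x) = `|a| * l1sum_norm x.
Proof.
rewrite {1}/l1sum_norm l1sum_scaleE; apply/cvg_lim => //.
by apply: cvgM; [exact: cvg_cst|exact: l1sumP].
Qed.

Fact l1sum_norm0_eq0 (x : l1sum) : l1sum_norm x = 0 -> x = 0.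
Proof.
move=> x0; apply: l1sum_eq => n; apply/eqP.
by rewrite -normr_le0 -x0 l1sum_coord_le.
Qed.

HB.instance Definition _ := Lmodule_isNormed.Build K l1sum
  l1sum_normD l1sum_normZ l1sum_norm0_eq0.

Lemma l1sum_complete (F : set_system l1sum) :
  ProperFilter F -> cauchy F -> cvg F.
Proof.
move=> FF cF.
pose y n : X n := lim ((fun x : l1sum => x n) @ F).
have Fy n : (fun x : l1sum => x n) @ F --> y n.
  apply: cauchy_cvg; apply: cauchy_lipschitz cF => u v.
  exact: (l1sum_coord_le (u - v)).
have Fsum N (d : K) : 0 < d -> F [set x : l1sum | \sum_(0 <= i < N) `|y i - x i| <= d].
  elim: N d => [|N IHN] d d0.
    by apply: filterE => x /=; rewrite big_geq// ltW.
  have d2 : 0 < d / 2 by rewrite divr_gt0// ltr0Sn.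
  move/cvgrPdist_le : (Fy N) => /(_ _ d2) FN.
  apply: filterS (filterI (IHN _ d2) FN) => x /= [xN xNd].
  by rewrite big_nat_recr//= (splitr d) lerD.
have near_y (e : K) (A : set l1sum) (x0 : l1sum) : 0 < e -> F A ->
    (forall x, A x -> `|x - x0| <= e) ->
    forall n, series (fun n => `|y n - x0 n|) n <= e.
  move=> e0 FA Ax0 N; apply/ler_addgt0Pr => d d0.
  have [x [Ax xd]] := filter_ex (filterI FA (Fsum N d d0)).
  apply: (@le_trans _ _ (\sum_(0 <= i < N) (`|x i - x0 i| + `|y i - x i|))).
    rewrite /series/= ler_sum// => i _.
    by rewrite [leRHS]addrC -(subrKA (x i)) ler_normD.
  rewrite big_split/= lerD//.
  exact: le_trans (l1sum_norm_ge (x - x0) N) (Ax0 x Ax).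
have cF' (e : K) : 0 < e -> exists2 x0 : l1sum,
    (forall n, series (fun n => `|y n - x0 n|) n <= e)
    & F [set x : l1sum | `|x - x0| <= e].
  move/cauchy_ballP : cF => cFb e0; have [[A B]/= [FA FB] AB] := cFb e e0.
  have [x0 Bx0] := filter_ex FB.
  have Ax0 x : A x -> `|x - x0| <= e.
    by move=> Ax; have := AB (x, x0) (conj Ax Bx0); rewrite -ball_normE/= => /ltW.
  by exists x0; [exact: near_y FA Ax0 | exact: filterS FA].
have yS : summable_seq y.
  have [x0 yx0 _] := cF' 1 ltr01.
  apply/summable_seqP; exists (1 + l1sum_norm x0) => N.
  apply: le_trans (lerD (yx0 N) (l1sum_norm_ge x0 N)).
  rewrite /series/= -big_split ler_sum// => i _ /=.
  by rewrite -{1}(subrK (x0 i) (y i)) ler_normD.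
apply/cvg_ex; exists (L1sum yS); apply/cvgrPdist_le => e e0.
have e2 : 0 < e / 2 by rewrite divr_gt0// ltr0Sn.
have [x0 yx0 Fx0] := cF' _ e2.
apply: filterS Fx0 => x /= xx0.
rewrite -(subrKA x0) (le_trans (ler_normD _ _))// (splitr e) lerD//.
  exact: (@l1sum_norm_le (L1sum yS - x0)).
by rewrite distrC.
Qed.

HB.instance Definition _ := Uniform_isComplete.Build l1sum l1sum_complete.

End l1_sum.

Section linfty.
Variables (k : scalar_kind) (R : realType).
Local Notation K := (scalar_field k R).

Definition bounded_seq (x : nat -> K) : Prop :=
  has_ubound (range (fun n => `|x n|)).

Record linfty := Linfty {
  linfty_fun :> nat -> K;
  linftyP : bounded_seq linfty_fun
}.

Lemma linfty_eq (x y : linfty) : (forall n, x n = y n) -> x = y.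
Proof.
case: x y => [x xP] [y yP] /= /funext xy.
by rewrite xy in xP *; rewrite (Prop_irrelevance xP yP).
Qed.

HB.instance Definition _ := gen_eqMixin linfty.
HB.instance Definition _ := gen_choiceMixin linfty.

Definition linfty_norm (x : linfty) : K :=
  supremum 0 (range (fun n => `|x n|)).

Lemma linfty_norm_isLub (x : linfty) :
  isLub (range (fun n => `|x n|)) (linfty_norm x).
Proof.
apply: scalar_supremum; last by move=> _ [n _ <-].
- by exists `|x 0|, 0.
- exact: linftyP.
Qed.

Lemma linfty_norm_ge (x : linfty) n : `|x n| <= linfty_norm x.
Proof. by apply: (linfty_norm_isLub x).1; exists n. Qed.

Lemma linfty_norm_le (x : linfty) M :
  (forall n, `|x n| <= M) -> linfty_norm x <= M.
Proof. by move=> xM; apply: (linfty_norm_isLub x).2 => _ [n _ <-]. Qed.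

Lemma bounded_seqP (x : nat -> K) M : (forall n, `|x n| <= M) -> bounded_seq x.
Proof. by move=> xM; exists M => _ [n _ <-]. Qed.

Lemma linfty_zero_subproof : bounded_seq (fun=> 0).
Proof. by apply: (@bounded_seqP _ 0) => n; rewrite normr0. Qed.

Lemma linfty_opp_subproof (x : linfty) : bounded_seq (fun n => - x n).
Proof.
apply: (@bounded_seqP _ (linfty_norm x)) => n.
by rewrite normrN linfty_norm_ge.
Qed.

Lemma linfty_addD (x y : linfty) n :
  `|x n + y n| <= linfty_norm x + linfty_norm y.
Proof. by rewrite (le_trans (ler_normD _ _))// lerD// linfty_norm_ge. Qed.

Lemma linfty_add_subproof (x y : linfty) : bounded_seq (fun n => x n + y n).
Proof. exact: bounded_seqP (linfty_addD x y). Qed.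

Lemma linfty_scaleD (a : K) (x : linfty) n :
  `|a * x n| <= `|a| * linfty_norm x.
Proof. by rewrite normrM ler_wpM2l// linfty_norm_ge. Qed.

Lemma linfty_scale_subproof (a : K) (x : linfty) :
  bounded_seq (fun n => a * x n).
Proof. exact: bounded_seqP (linfty_scaleD a x). Qed.

Definition linfty_zero := Linfty linfty_zero_subproof.
Definition linfty_opp x := Linfty (@linfty_opp_subproof x).
Definition linfty_add x y := Linfty (@linfty_add_subproof x y).
Definition linfty_scale a x := Linfty (@linfty_scale_subproof a x).

Fact linfty_addA : associative linfty_add.
Proof. by move=> x y z; apply: linfty_eq => n; exact: addrA. Qed.
Fact linfty_addC : commutative linfty_add.
Proof. by move=> x y; apply: linfty_eq => n; exact: addrC. Qed.
Fact linfty_add0 : left_id linfty_zero linfty_add.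
Proof. by move=> x; apply: linfty_eq => n; exact: add0r. Qed.
Fact linfty_addN : left_inverse linfty_zero linfty_opp linfty_add.
Proof. by move=> x; apply: linfty_eq => n; exact: addNr. Qed.

HB.instance Definition _ := GRing.isZmodule.Build linfty
  linfty_addA linfty_addC linfty_add0 linfty_addN.

Fact linfty_scaleA a b (x : linfty) :
  linfty_scale a (linfty_scale b x) = linfty_scale (a * b) x.
Proof. by apply: linfty_eq => n; exact: mulrA. Qed.
Fact linfty_scale1 : left_id 1 linfty_scale.
Proof. by move=> x; apply: linfty_eq => n; exact: mul1r. Qed.
Fact linfty_scaleDr : right_distributive linfty_scale +%R.
Proof. by move=> a x y; apply: linfty_eq => n; exact: mulrDr. Qed.
Fact linfty_scaleDl (x : linfty) : {morph linfty_scale^~ x : a b / a + b}.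
Proof. by move=> a b; apply: linfty_eq => n; exact: mulrDl. Qed.

HB.instance Definition _ := GRing.Zmodule_isLmodule.Build K linfty
  linfty_scaleA linfty_scale1 linfty_scaleDr linfty_scaleDl.

Fact linfty_normD (x y : linfty) :
  linfty_norm (x + y) <= linfty_norm x + linfty_norm y.
Proof. by apply: linfty_norm_le => n; exact: linfty_addD. Qed.

Fact linfty_normZ a (x : linfty) : linfty_norm (a *: x) = `|a| * linfty_norm x.
Proof.
apply/eqP; rewrite eq_le linfty_norm_le ?andTb; last exact: linfty_scaleD.
have [->|a0] := eqVneq a 0.
  by rewrite normr0 mul0r (le_trans _ (linfty_norm_ge _ 0)).
rewrite -ler_pdivlMl ?normr_gt0//; apply: linfty_norm_le => n.
rewrite ler_pdivlMl ?normr_gt0// -normrM.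
exact: (linfty_norm_ge (a *: x)).
Qed.

Fact linfty_norm0_eq0 (x : linfty) : linfty_norm x = 0 -> x = 0.
Proof.
move=> x0; apply: linfty_eq => n; apply/eqP.
by rewrite -normr_le0 -x0 linfty_norm_ge.
Qed.

HB.instance Definition _ := Lmodule_isNormed.Build K linfty
  linfty_normD linfty_normZ linfty_norm0_eq0.

Lemma linfty_complete (F : set_system linfty) :
  ProperFilter F -> cauchy F -> cvg F.
Proof.
move=> FF cF.
pose y n : K := lim ((fun x : linfty => x n) @ F).
have Fy n : (fun x : linfty => x n) @ F --> y n.
  apply: scalar_complete.
  apply: (@cauchy_lipschitz _ linfty (K^o) (fun x => x n)) cF => u v.
  exact: (linfty_norm_ge (u - v)).
have cF' (e : K) : 0 < e -> exists2 x0 : linfty,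
    (forall n, `|y n - x0 n| <= e) & F [set x : linfty | `|x - x0| <= e].
  move/cauchy_ballP : cF => cFb e0; have [[A B]/= [FA FB] AB] := cFb e e0.
  have [x0 Bx0] := filter_ex FB.
  have Ax0 x : A x -> `|x - x0| <= e.
    by move=> Ax; have := AB (x, x0) (conj Ax Bx0); rewrite -ball_normE/= => /ltW.
  exists x0; last exact: filterS FA.
  move=> n; apply/ler_addgt0Pr => d d0.
  move/cvgrPdist_le : (Fy n) => /(_ _ d0) Fn.
  have [x [Ax xd]] := filter_ex (filterI FA Fn).
  rewrite -(subrKA (x n)) addrC (le_trans (ler_normD _ _))// lerD//.
  exact: le_trans (linfty_norm_ge (x - x0) n) (Ax0 x Ax).
have yB : bounded_seq y.
  have [x0 yx0 _] := cF' 1 ltr01.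
  apply: (@bounded_seqP _ (1 + linfty_norm x0)) => n.
  rewrite -(subrK (x0 n) (y n)) (le_trans (ler_normD _ _))// lerD//.
  exact: linfty_norm_ge.
apply/cvg_ex; exists (Linfty yB); apply/cvgrPdist_le => e e0.
have e2 : 0 < e / 2 by rewrite divr_gt0// ltr0Sn.
have [x0 yx0 Fx0] := cF' _ e2.
apply: filterS Fx0 => x /= xx0.
rewrite -(subrKA x0) (le_trans (ler_normD _ _))// (splitr e) lerD//.
  exact: (@linfty_norm_le (Linfty yB - x0)).
by rewrite distrC.
Qed.

HB.instance Definition _ := Uniform_isComplete.Build linfty linfty_complete.

End linfty.

Definition l1 (k : scalar_kind) (R : realType) :
    completeNormedModType (scalar_field k R) :=
  l1sum (fun _ => scalar_field k R : completeNormedModType (scalar_field k R)).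

(* Indices are shifted by one: the [n]-th summand has dimension [n.+1]. *)
Definition l1sum_linfty (k : scalar_kind) (R : realType) :
    completeNormedModType (scalar_field k R) :=
  l1sum (fun n =>
    'rV[scalar_field k R]_n.+1 : completeNormedModType (scalar_field k R)).

Section operators.
Variables (k : scalar_kind) (R : realType).
Local Notation K := (scalar_field k R).
Implicit Types X Y : completeNormedModType K.

Definition bounded_op X Y : set (X -> Y) :=
  [set T | linear T /\ exists M, forall x, `|T x| <= M * `|x|].

(* The default value [0] is never used for a bounded operator: the supremum is
   then a least upper bound for the order of [K], see [opnorm_isLub]. *)
Definition opnorm X Y (T : X -> Y) : K :=
  supremum 0 [set `|T x| | x in [set x | `|x| <= 1]].

Lemma opnorm_isLub X Y (T : X -> Y) : bounded_op T ->
  isLub [set `|T x| | x in [set x | `|x| <= 1]] (opnorm T).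
Proof.
move=> [_ [M TM]]; apply: scalar_supremum; last by move=> _ [x _ <-].
  by exists `|T 0|, 0 => //=; rewrite normr0.
exists `|M| => _ [x /= x1 <-]; rewrite (le_trans (TM x))//.
have [->|x0] := eqVneq x 0; first by rewrite normr0 mulr0.
have x_gt0 : 0 < `|x| by rewrite normr_gt0.
have Mreal : M \is Num.real.
  rewrite -[M](mulfK (lt0r_neq0 x_gt0)) realM ?realV ?ger0_real//.
  exact: le_trans (TM x).
by rewrite (le_trans (ler_wpM2r _ (real_ler_norm Mreal)))// ler_piMr.
Qed.

Definition opnorm_closure X Y (A : set (X -> Y)) : set (X -> Y) :=
  [set T | bounded_op T /\
    forall e : K, 0 < e -> exists2 S, A S & opnorm (T \- S) < e].

(* An inverse on the range of [theta] is automatically linear there. *)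
Definition embedding X Y (theta : X -> Y) : Prop :=
  [/\ bounded_op theta, closed (range theta) &
    exists2 S : Y -> X, cancel theta S &
      exists M, forall y, range theta y -> `|S y| <= M * `|y|].

Definition factor_l1 X Y : set (X -> Y) :=
  [set T | exists (U : X -> l1 k R) (S : l1 k R -> Y),
    [/\ bounded_op U, bounded_op S & T = S \o U]].

Definition Gi_l1 X : set (X -> X) :=
  [set T | bounded_op T /\ exists2 theta : X -> linfty k R, embedding theta &
    opnorm_closure (@factor_l1 X (linfty k R)) (theta \o T)].

Definition ideal X (I : set (X -> X)) : Prop :=
  [/\ I `<=` @bounded_op X X,
      I (fun=> 0),
      forall S T, I S -> I T -> I (fun x => S x + T x) &
      forall A T B, bounded_op A -> I T -> bounded_op B -> I (A \o T \o B)].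

Definition proper_ideal X (I : set (X -> X)) : Prop :=
  ideal I /\ I `<` @bounded_op X X.

Definition maximal_ideal X (I : set (X -> X)) : Prop :=
  proper_ideal I /\ forall J, proper_ideal J -> I `<=` J -> J = I.

End operators.

(* Main.v *)
From HB Require Import structures.
Require Import Defs.
From mathcomp Require Import all_boot all_order all_algebra.
From mathcomp Require Import all_classical all_reals all_analysis.
From mathcomp Require Import complex ring lra zify.
Import Order.TTheory GRing.Theory Num.Theory.
Import numFieldNormedType.Exports.
Local Open Scope classical_set_scope.
Set Implicit Arguments.
Unset Strict Implicit.
Unset Printing Implicit Defensive.

(** The proof rests on one intrinsic property of an operator $T$ on $E$. Fix a
    concrete embedding $\theta : E \to \ell^\infty$. Its coordinates turn the
    restriction of $T$ to the $n$-th summand into a family of rows, vectors of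
    $\ell^1$ of finite length. Call $T$ order bounded if, up to errors of
    arbitrarily small $\ell^1$-norm, the rows belonging to one summand lie in an
    order interval $[-g, g]$ whose length $\|g\|_1$ is bounded independently of
    the summand. Three implications form a circle.

    Order bounded operators belong to $\mathcal{G}^i_{\ell^1}(E)$
    (order_bounded_Gi): divided by $g$, the rows have entries of modulus at most
    1, so that $\theta T$ is, up to a small error, multiplication by the bounds
    $g$, a map into $\ell^1$, followed by a bounded map $\ell^1 \to \ell^\infty$.

    The identity does not factor through an operator in
    $\mathcal{G}^i_{\ell^1}(E)$ (Gi_not_factor_id): otherwise an operator
    $E \to \ell^1$ would be bounded below. This is impossible because in
    $\ell^1$ some signed sum of $3^m$ vectors is at least $(3/2)^m$ times as long
    as their average, by an iteration of Hlawka's inequality, whereas signed sums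
    of unit coordinate vectors in $\ell^\infty(n)$ have norm 1.

    If $T$ is not order bounded, the identity factors through $T$
    (not_order_bounded_factor). In suitable summands there are long
    lists of rows each of which exceeds a huge multiple of the sum of its
    predecessors on a set that carries a fixed amount of its mass
    (escaping_rows). These sets can be made disjoint (disjoint_carriers), and
    the unimodular vectors on them span copies of $\ell^\infty(N)$. Against
    these vectors the matrix of the rows has a large diagonal and is small on one
    side of it; on the other side its rows are summable, so a combinatorial
    selection (sparse_subseq) makes it nearly diagonal. The same summability
    discards the vectors whose images are large on finitely many given summands
    (almost_biorthogonal). A gliding hump then combines the systems so obtained
    for all dimensions into $A, B$ with $\|ATB - 1\| \le 1/2$, and a
    Neumann series inverts $ATB$.

    Hence $\mathcal{G}^i_{\ell^1}(E)$ consists both of the order bounded operators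
    and of the operators through which the identity does not factor. The first
    description shows that it is closed under sums, the second that it is stable
    under composition and contains every proper ideal. *)

(** * Linear maps, scalars and bounded operators *)

Section linear_maps.
Local Open Scope ring_scope.
Variables (K : numFieldType) (X Y : lmodType K) (T : X -> Y).
Hypothesis linT : linear T.

Lemma lin0 : T 0 = 0.
Proof.
by have := linT (-1) 0 0; rewrite addr0 !scaleN1r oppr0 addNr.
Qed.

Lemma linD u v : T (u + v) = T u + T v.
Proof. by have := linT 1 u v; rewrite !scale1r. Qed.

Lemma linZ a u : T (a *: u) = a *: T u.
Proof. by have := linT a u 0; rewrite !addr0 lin0 addr0. Qed.

Lemma linN u : T (- u) = - T u.
Proof. by rewrite -scaleN1r linZ scaleN1r. Qed.

Lemma linB u v : T (u - v) = T u - T v.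
Proof. by rewrite linD linN. Qed.

Lemma lin_sum I (r : seq I) (P : pred I) (F : I -> X) :
  T (\sum_(i <- r | P i) F i) = \sum_(i <- r | P i) T (F i).
Proof. exact: (big_morph T linD lin0). Qed.
End linear_maps.

Section scalars.
Local Open Scope ring_scope.
Variables (k : scalar_kind) (R : realType).
Local Notation K := (scalar_field k R).

Lemma scalar_archi (x : K) : 0 <= x -> exists n : nat, x <= n%:R.
Proof.
case: k x => /= x x0.
  by exists (Num.bound x); rewrite ltW// archi_boundP.
exists (Num.bound (complex.Re x)).
have xE : x = (complex.Re x)%:C%C by rewrite RRe_real// ger0_real.
have y0 : 0 <= complex.Re x by rewrite -lecR -xE.
by rewrite xE -(rmorph_nat (real_complex R)) lecR ltW// archi_boundP.
Qed.

Lemma scalar_archi_inv (e : K) : 0 < e -> exists n : nat, n.+1%:R^-1 <= e.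
Proof.
move=> e0; have [|n ne] := @scalar_archi e^-1; first by rewrite invr_ge0 ltW.
exists n; rewrite invf_ple ?posrE//; apply: le_trans ne _.
by rewrite ler_nat.
Qed.

(** Norms live in a partially ordered field, so this is the form in which
    the negation of an upper bound has to be used. *)
Lemma pos_ltNge (x y : K) : 0 <= x -> 0 <= y -> ~~ (x <= y) -> y < x.
Proof. by move=> x0 y0; rewrite real_ltNge ?ger0_real. Qed.

Let rV_normE n (v : 'rV[K]_n) : `|v| = mx_norm v. Proof. by []. Qed.

Lemma norm_rV_coord n (v : 'rV[K]_n) i : `|v ord0 i| <= `|v|.
Proof.
rewrite rV_normE mx_normE -[leLHS]nngE num_le.
exact: (le_bigmax _ (fun i : 'I_1 * 'I_n => `|v i.1 i.2|%:nng) (ord0, i)).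
Qed.

Lemma norm_rV_le n (v : 'rV[K]_n) M : 0 <= M ->
  (forall i, `|v ord0 i| <= M) -> `|v| <= M.
Proof.
move=> M0 vM; have [v0|] := eqVneq (mx_norm v) 0; first by rewrite rV_normE v0.
by move=> /mx_norm_neq0[[i j]/=]; rewrite rV_normE => ->; rewrite (ord1 i).
Qed.

Lemma norm_rV_attained n (v : 'rV[K]_n.+1) : exists i, `|v| = `|v ord0 i|.
Proof.
have [v0|] := eqVneq (mx_norm v) 0.
  exists ord0; have nv0 : `|v| = 0 by rewrite rV_normE.
  by rewrite nv0; apply/eqP; rewrite eq_le normr_ge0 -nv0 norm_rV_coord.
by move=> /mx_norm_neq0[[i j]/=]; rewrite (ord1 i) => vE; exists j.
Qed.

End scalars.

Section bounded_operators.
Local Open Scope ring_scope.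
Variables (k : scalar_kind) (R : realType).
Local Notation K := (scalar_field k R).
Implicit Types X Y Z : completeNormedModType K.

Lemma bounded_opP X Y (T : X -> Y) : bounded_op T ->
  exists2 M : K, 0 < M & forall x, `|T x| <= M * `|x|.
Proof.
move=> [_ [M TM]]; exists (`|M| + 1); first by rewrite ltr_wpDl.
move=> x; have [->|x0] := eqVneq x 0.
  by rewrite (le_trans (TM 0))// normr0 !mulr0.
have x_gt0 : 0 < `|x| by rewrite normr_gt0.
have M0 : 0 <= M by rewrite -(pmulr_lge0 _ x_gt0) (le_trans _ (TM x)).
by rewrite (le_trans (TM x))// ler_pM2r// ger0_norm// lerDl.
Qed.

Lemma bounded_id X : bounded_op (idfun : X -> X).
Proof. by split; [|exists 1 => x; rewrite mul1r]. Qed.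

Lemma bounded_comp X Y Z (S : Y -> Z) (T : X -> Y) :
  bounded_op S -> bounded_op T -> bounded_op (S \o T).
Proof.
move=> bS bT; have [linS _] := bS; have [linT _] := bT; split.
  by move=> a u v; rewrite /= linT linS.
have [s s0 Ss] := bounded_opP bS; have [t t0 Tt] := bounded_opP bT.
exists (s * t) => x /=; rewrite (le_trans (Ss _))//.
by rewrite -mulrA ler_pM2l.
Qed.

Lemma bounded_add X Y (S T : X -> Y) :
  bounded_op S -> bounded_op T -> bounded_op (fun x => S x + T x).
Proof.
move=> bS bT; have [linS _] := bS; have [linT _] := bT; split.
  by move=> a u v; rewrite /= linT linS scalerDr addrACA.
have [s s0 Ss] := bounded_opP bS; have [t t0 Tt] := bounded_opP bT.
by exists (s + t) => x /=; rewrite (le_trans (ler_normD _ _))// mulrDl lerD.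
Qed.

Lemma bounded_sub X Y (S T : X -> Y) :
  bounded_op S -> bounded_op T -> bounded_op (S \- T).
Proof.
move=> bS bT; have [linS _] := bS; have [linT _] := bT; split.
  by move=> a u v; rewrite /= linT linS scalerBr opprD addrACA.
have [s s0 Ss] := bounded_opP bS; have [t t0 Tt] := bounded_opP bT.
exists (s + t) => x /=; rewrite (le_trans (ler_normB _ _))// mulrDl lerD//.
Qed.

Lemma opnorm_ge X Y (T : X -> Y) : bounded_op T ->
  forall x, `|T x| <= opnorm T * `|x|.
Proof.
move=> bT x; have [linT _] := bT.
have [->|x0] := eqVneq x 0; first by rewrite lin0// !normr0 mulr0.
have x_gt0 : 0 < `|x| by rewrite normr_gt0.
rewrite -ler_pdivrMr//.
have -> : `|T x| / `|x| = `|T (`|x|^-1 *: x)|.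
  by rewrite linZ// normrZ normfV normr_id mulrC.
apply: (opnorm_isLub bT).1; exists (`|x|^-1 *: x) => //=.
by rewrite normrZ normfV normr_id mulVf ?lt0r_neq0.
Qed.

Lemma opnorm_le X Y (T : X -> Y) M : bounded_op T -> 0 <= M ->
  (forall x, `|T x| <= M * `|x|) -> opnorm T <= M.
Proof.
move=> bT M0 TM; apply: (opnorm_isLub bT).2 => _ [x /= x1 <-].
by rewrite (le_trans (TM x))// ler_piMr.
Qed.

Lemma cvgn_cauchy X (s : nat -> X) :
  (forall e : K, 0 < e -> exists N, forall n, (N <= n)%N -> `|s n - s N| <= e) ->
  cvgn s.
Proof.
move=> sC; apply: cauchy_cvg; apply: cauchy_exP => e e0.
have e2 : 0 < e / 2 by rewrite divr_gt0.
have [N sN] := sC _ e2; exists (s N); exists N => // n /= Nn.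
rewrite -ball_normE /= distrC (le_lt_trans (sN _ Nn))//.
by rewrite gtr_pMr// invf_lt1// ltr1n.
Qed.

Lemma cvgn_norm_le X (s : nat -> X) l M : s @ \oo --> l ->
  (forall n, `|s n| <= M) -> `|l| <= M.
Proof.
move=> sl sM; apply: (@cvgn_le _ (fun n => `|s n|)); first exact: cvg_norm.
by exists 0.
Qed.

Lemma exp2_small (c e : K) : 0 <= c -> 0 < e -> exists n, c / 2 ^+ n <= e.
Proof.
move=> c0 e0; have [|n ne] := @scalar_archi k R (c / e).
  by rewrite divr_ge0// ltW.
exists n; rewrite ler_pdivrMr ?exprn_gt0// mulrC -ler_pdivrMr//.
by rewrite (le_trans ne)// -natrX ler_nat ltnW// ltn_expl.
Qed.

(** The Neumann series: the partial sums of $\sum_n (1 - W)^n$ converge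
    pointwise to a left inverse of $W$. *)
Lemma left_inverse_near_id X (W : X -> X) : linear W ->
  (forall x, `|W x - x| <= 2^-1 * `|x|) ->
  exists2 V : X -> X, bounded_op V & V \o W = idfun.
Proof.
move=> linW WI; pose D x := x - W x.
have linD' : linear D.
  by move=> a u v; rewrite /D linW scalerBr opprD addrACA.
have Dle x : `|D x| <= 2^-1 * `|x| by rewrite /D distrC.
have DnE n x : `|iter n D x| <= `|x| / 2 ^+ n.
  elim: n => [|n IH]; first by rewrite expr0 divr1.
  rewrite iterS (le_trans (Dle _))// exprS invfM mulrCA ler_wpM2l//.
pose S n x := \sum_(0 <= i < n) iter i D x.
have linDn n : linear (iter n D).
  by elim: n => [//|n IH] a u v; rewrite !iterS IH linD'.
have linS n : linear (S n).
  move=> a u v; rewrite /S scaler_sumr -big_split; apply: eq_bigr => i _.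
  exact: linDn.
have Sdist n m x : (n <= m)%N ->
    `|S m x - S n x| <= 2 * `|x| / 2 ^+ n - 2 * `|x| / 2 ^+ m.
  move=> /subnK <-; elim: (m - n)%N => [|d IH]; first by rewrite !subrr normr0.
  rewrite addSn /S big_nat_recr//= -/(S _ x) addrAC (le_trans (ler_normD _ _))//.
  rewrite (le_trans (lerD IH (DnE _ _)))// -addrA lerD2l.
  rewrite exprS -mulf_div divff ?pnatr_eq0// mul1r -mulrA mulr_natl mulr2n.
  by rewrite opprD subrK.
have Sle n x : `|S n x| <= 2 * `|x|.
  have := Sdist 0 n x (leq0n n); rewrite {2}/S big_geq// subr0 expr0 divr1.
  by move=> /le_trans; apply; rewrite lerBlDr lerDl divr_ge0// mulr_ge0.
have Scvg x : cvgn (S ^~ x).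
  apply: cvgn_cauchy => e e0.
  have [|N Ne] := @exp2_small (2 * `|x|) e _ e0; first by rewrite mulr_ge0.
  exists N => n Nn; rewrite (le_trans _ Ne)// (le_trans (Sdist _ _ _ Nn))//.
  by rewrite lerBlDr lerDl divr_ge0// mulr_ge0.
pose V x : X := limn (S ^~ x).
have VP x : S n x @[n --> \oo] --> V x by exact: Scvg.
exists V.
  split.
    move=> a u v; apply: cvg_lim => //=.
    rewrite (_ : S ^~ (a *: u + v) = fun n => a *: S n u + S n v); last first.
      by apply/funext => n; rewrite linS.
    by apply: cvgD; [apply: cvgZl_tmp | ]; exact: VP.
  by exists 2 => x; apply: cvgn_norm_le (VP x) _.
apply/funext => x /=; apply: cvg_lim => //.
have SWE n : S n (W x) = x - iter n D x.
  elim: n => [|n IH]; first by rewrite /S big_geq// subrr.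
  rewrite /S big_nat_recr//= -/(S n _) IH.
  have -> : iter n D (W x) = iter n D x - iter n.+1 D x.
    rewrite iterSr -(linB (linDn n)); congr (iter n D _).
    by rewrite /D opprB addrC subrK.
  by rewrite addrA subrK.
apply/cvgrPdist_le => e e0.
have [N Ne] := @exp2_small `|x| e (normr_ge0 _) e0.
exists N => // n /= Nn; rewrite SWE opprB addrC subrK (le_trans (DnE _ _))//.
rewrite (le_trans _ Ne)// ler_wpM2l// lef_pV2 ?posrE ?exprn_gt0//.
by rewrite ler_eXn2l// ltr1n.
Qed.

End bounded_operators.

(** * Operators on $\ell^1$-sums *)

Section l1_sums.
Local Open Scope ring_scope.
Variables (k : scalar_kind) (R : realType).
Local Notation K := (scalar_field k R).
Variable X : nat -> completeNormedModType K.
Implicit Types (x : l1sum X) (D : pred nat).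

Lemma l1sum_partial_le x N : \sum_(0 <= i < N) `|x i| <= `|x|.
Proof. exact: (l1sum_norm_ge x N). Qed.

Lemma l1sum_le x M : (forall N, \sum_(0 <= i < N) `|x i| <= M) -> `|x| <= M.
Proof. exact: l1sum_norm_le. Qed.

Lemma l1_restrict_subproof D x : summable_seq (fun n => if D n then x n else 0).
Proof.
apply/summable_seqP; exists `|x| => N.
apply: le_trans (l1sum_partial_le x N).
by apply: ler_sum => i _; case: ifP => // _; rewrite normr0.
Qed.

Definition l1_restrict D x : l1sum X := L1sum (@l1_restrict_subproof D x).

Lemma l1_restrict_linear D : linear (l1_restrict D).
Proof.
move=> a u v; apply: l1sum_eq => n /=; case: ifP => // _.
by rewrite /= scaler0 addr0.
Qed.

Lemma l1_restrict_id D x : l1_restrict D x + l1_restrict (predC D) x = x.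
Proof.
by apply: l1sum_eq => n /=; case: (D n); rewrite /= ?addr0 ?add0r.
Qed.

Lemma l1_restrict_interval_le a b x :
  `|l1_restrict (fun n => (a <= n < b)%N) x| <= \sum_(a <= n < b) `|x n|.
Proof.
apply: l1sum_le => N; rewrite big_mkord.
rewrite -(big_mkord xpredT (fun n => `|l1_restrict _ x n|)) /=.
rewrite (eq_bigr (fun n => if (a <= n < b)%N then `|x n| else 0)); last first.
  by move=> n _; case: ifP => // _; rewrite normr0.
rewrite -big_mkcond /=.
have [le_ab|lt_ba] := leqP a b; last first.
  rewrite big1 ?big_geq ?(ltnW lt_ba)// => n /andP[an nb].
  by have := leq_ltn_trans an (ltn_trans nb lt_ba); rewrite ltnn.
rewrite (@big_nat_widenl _ _ _ a 0)//=.
rewrite (@big_nat_widen _ _ _ 0 b (maxn N b)) ?leq_maxr//.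
rewrite (@big_nat_widen _ _ _ 0 N (maxn N b)) ?leq_maxl//.
rewrite big_mkcond [leRHS]big_mkcond /=; apply: ler_sum => n _.
case: (a <= n)%N; rewrite /= ?andbF//.
by case: (n < b)%N => //=; case: (n < N)%N.
Qed.

Lemma l1_tail_small x (e : K) : 0 < e ->
  exists N0, forall N, (N0 <= N)%N ->
    `|l1_restrict (fun n => ~~ (n < N)%N) x| <= e.
Proof.
move=> e0; have xc : summable_seq x by exact: l1sumP.
have /cvgrPdist_le/(_ e e0)[N0 _ H] : series (fun n => `|x n|) @ \oo --> `|x|.
  exact: xc.
exists N0 => N N0N; have := H N N0N => /=.
have sx : series (fun n => `|x n|) N <= `|x| by exact: l1sum_partial_le.
rewrite ger0_norm ?subr_ge0// => xe; apply: l1sum_le => m.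
apply: le_trans xe; rewrite lerBrDr.
apply: le_trans (l1sum_partial_le x (maxn m N)).
rewrite (@big_nat_widen _ _ _ 0 m (maxn m N)) ?leq_maxl// big_mkcond /=.
rewrite {1}/series /= (@big_nat_widen _ _ _ 0 N (maxn m N)) ?leq_maxr//.
rewrite [X in _ + X]big_mkcond -big_split; apply: ler_sum => n _ /=.
case: (n < N)%N => /=; first by rewrite normr0 if_same add0r.
by rewrite addr0; case: ifP.
Qed.

Lemma l1_single_subproof n (v : X n) : summable_seq (fun m =>
  match @eqP _ n m with ReflectT e => eq_rect n (fun m => X m : Type) v m e
  | ReflectF _ => 0 : X m end).
Proof.
apply/summable_seqP; exists `|v| => N; rewrite /series/=.
case: (ltnP n N) => nN; last first.
  rewrite big1_seq// => i /=; rewrite mem_index_iota => /andP[_ iN].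
  case: eqP => [e|]; last by rewrite normr0.
  by have := leq_trans iN nN; rewrite -{1}e ltnn.
rewrite (bigD1_seq n) ?mem_index_iota ?iota_uniq//= big1; last first.
  move=> i; case: eqP => [e|]; last by rewrite normr0.
  by rewrite -{1}e eqxx.
by rewrite addr0; case: eqP => // e; rewrite (Prop_irrelevance e erefl).
Qed.

(** The summands have different types, so the vector is transported along an
    equality of indices. *)
Definition l1_single n (v : X n) : l1sum X := L1sum (@l1_single_subproof n v).

Lemma l1_single_same n (v : X n) : l1_single v n = v.
Proof. by rewrite /=; case: eqP => // e; rewrite (Prop_irrelevance e erefl). Qed.

Lemma l1_single_other n (v : X n) m : m != n -> l1_single v m = 0.
Proof. by rewrite /=; case: eqP => // e; rewrite -{1}e eqxx. Qed.

Lemma l1_single_linear n : linear (@l1_single n).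
Proof.
move=> a u v; apply: l1sum_eq => m; rewrite /l1_single /=.
case: eqP => [e|_]; last by rewrite scaler0 addr0.
by case: m / e.
Qed.

Lemma l1_single_le n (v : X n) : `|l1_single v| <= `|v|.
Proof.
apply: l1sum_le => N.
case: (ltnP n N) => nN; last first.
  rewrite big1_seq// => i /andP[_]; rewrite mem_index_iota => /andP[_ iN].
  rewrite l1_single_other ?normr0//.
  by rewrite neq_ltn (leq_trans iN nN).
rewrite (bigD1_seq n) ?mem_index_iota ?iota_uniq// big1; last first.
  by move=> i ni; rewrite l1_single_other ?normr0.
by rewrite l1_single_same /= addr0.
Qed.

Lemma l1_sum_app I (r : seq I) (P : pred I) (F : I -> l1sum X) m :
  (\sum_(i <- r | P i) F i) m = \sum_(i <- r | P i) F i m.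
Proof. exact: (big_morph (fun x : l1sum X => x m)). Qed.

Lemma l1_restrict_single x N :
  l1_restrict (fun n => (n < N)%N) x = \sum_(0 <= n < N) l1_single (x n).
Proof.
apply: l1sum_eq => m; rewrite l1_sum_app [LHS]/=; case: ltnP => mN.
  rewrite (bigD1_seq m) ?mem_index_iota ?iota_uniq// l1_single_same.
  by rewrite big1 ?Monoid.mulm1// => i im; rewrite l1_single_other// eq_sym.
rewrite big1_seq// => i /andP[_]; rewrite mem_index_iota => /andP[_ iN].
by rewrite l1_single_other// neq_ltn (leq_trans iN mN) orbT.
Qed.

(** Finitely supported vectors are dense, so a bounded operator on an
    $\ell^1$-sum has the norm of its restrictions to the summands. *)
Lemma l1sum_op_le (Y : completeNormedModType K) (T : l1sum X -> Y) (c : K) :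
  bounded_op T -> 0 <= c -> (forall n (v : X n), `|T (l1_single v)| <= c * `|v|) ->
  forall x, `|T x| <= c * `|x|.
Proof.
move=> bT c0 Tc x; have [linT _] := bT; have [M M0 TM] := bounded_opP bT.
apply/ler_addgt0Pr => e e0.
have [N /(_ _ (leqnn N)) xN] := @l1_tail_small x (e / M) (divr_gt0 e0 M0).
rewrite -(l1_restrict_id (fun n => (n < N)%N) x) linD// (le_trans (ler_normD _ _))//.
rewrite l1_restrict_id lerD//; last first.
  by rewrite (le_trans (TM _))// mulrC -ler_pdivlMr.
rewrite l1_restrict_single lin_sum// (le_trans (ler_norm_sum _ _ _))//.
rewrite (le_trans (ler_sum _ (fun n _ => Tc n (x n))))// -mulr_sumr.
by rewrite ler_wpM2l// l1sum_partial_le.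
Qed.

(** The universal property of $\ell^1$-sums: on a summable sequence the partial
    sums of the values of uniformly bounded maps are Cauchy. *)
Lemma l1sum_lift (Y : completeNormedModType K) (phi : forall n, X n -> Y) (c : K) :
  0 <= c -> (forall n, linear (phi n)) -> (forall n v, `|phi n v| <= c * `|v|) ->
  exists T : l1sum X -> Y,
    [/\ bounded_op T, forall x, `|T x| <= c * `|x| &
        forall n v, T (l1_single v) = phi n v].
Proof.
move=> c0 linphi phic.
pose s x N : Y := \sum_(0 <= n < N) phi n (x n).
have scvg x : cvgn (s x).
  apply: cvgn_cauchy => e e0.
  have c1 : 0 < c + 1 by rewrite ltr_wpDl.
  have [N xN] := @l1_tail_small x (e / (c + 1)) (divr_gt0 e0 c1).
  exists N => n Nn; rewrite /s (big_cat_nat (leq0n N) Nn)/= addrAC subrr add0r.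
  rewrite (le_trans (ler_norm_sum _ _ _))//.
  rewrite (le_trans (ler_sum _ (fun n _ => phic n (x n))))// -mulr_sumr.
  have /xN xNe := leqnn N.
  apply: (@le_trans _ _ ((c + 1) * (e / (c + 1)))); last first.
    by rewrite mulrC divfK// lt0r_neq0.
  rewrite ler_pM// ?sumr_ge0// ?lerDl//; apply: le_trans xNe.
  apply: le_trans (l1sum_partial_le _ n).
  rewrite (@big_nat_widenl _ _ _ N 0)//= big_mkcond ler_sum// => i _ /=.
  by rewrite -leqNgt; case: ifP => // _; rewrite normr0.
pose T x : Y := limn (s x).
have TP x : s x n @[n --> \oo] --> T x by exact: scvg.
have Tle x : `|T x| <= c * `|x|.
  apply: cvgn_norm_le (TP x) _ => N.
  rewrite (le_trans (ler_norm_sum _ _ _))//.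
  rewrite (le_trans (ler_sum _ (fun n _ => phic n (x n))))// -mulr_sumr.
  by rewrite ler_wpM2l// l1sum_partial_le.
exists T; split => //.
  split; last by exists c.
  move=> a u v; apply: cvg_lim => //=.
  rewrite (_ : s (a *: u + v) = fun n => a *: s u n + s v n); last first.
    apply/funext => n; rewrite /s scaler_sumr -big_split.
    by apply: eq_bigr => i _; exact: linphi.
  by apply: cvgD; [apply: cvgZl_tmp | ]; exact: TP.
move=> n v; apply: cvg_lim => //; apply/cvgrPdist_le => e e0.
exists n.+1 => // N /= nN; rewrite /s (bigD1_seq n) ?mem_index_iota ?iota_uniq//.
rewrite big1 ?Monoid.mulm1; first by rewrite l1_single_same subrr normr0 ltW.
move=> i ni; rewrite l1_single_other//.
exact: (lin0 (linphi i)).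
Qed.

End l1_sums.

(** * A norming embedding into $\ell^\infty$ *)

Section norming_embedding.
Local Open Scope ring_scope.
Variables (k : scalar_kind) (R : realType).
Local Notation K := (scalar_field k R).
Local Notation E := (l1sum_linfty k R).

(** The range is closed because preimages of a convergent sequence form a Cauchy
    sequence in the complete domain. *)
Lemma embedding_of_lower_bound (X Y : completeNormedModType K) (T : X -> Y) (c : K) :
  0 < c -> bounded_op T -> (forall x, `|x| <= c * `|T x|) -> embedding T.
Proof.
move=> c0 bT cT; have [linT _] := bT; have [M M0 TM] := bounded_opP bT.
have Tinj x y : T x = T y -> x = y.
  move=> Txy; apply/eqP; rewrite -subr_eq0 -normr_le0 (le_trans (cT _))//.
  by rewrite linB// Txy subrr normr0 mulr0.
split=> //.
  move=> y yT.
  have near_y e : 0 < e -> exists x, `|T x - y| < e.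
    move=> e0; have [_ [[x _ <-]]] := yT _ (nbhsx_ballx y e e0).
    by rewrite -ball_normE /= distrC => xe; exists x.
  have near_y' (n : nat) : exists x, `|T x - y| < n.+1%:R^-1.
    by apply: near_y; rewrite invr_gt0.
  have [s sP] := choice near_y'.
  have /cvg_ex[/= l sl] : cvgn s.
    apply: cvgn_cauchy => e e0.
    have [|N Ne] := @scalar_archi_inv k R (e / (c * 2)).
      by rewrite divr_gt0// mulr_gt0.
    exists N => n Nn; rewrite (le_trans (cT _))// linB//.
    have -> : e = c * (e / (c * 2) + e / (c * 2)).
      by rewrite -mulr2n -[_ *+ 2 in RHS]mulr_natr mulrCA divfK// mulf_neq0 ?lt0r_neq0.
    rewrite ler_wpM2l ?(ltW c0)// -(subrKA y) (le_trans (ler_normD _ _))// lerD//.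
      rewrite (le_trans (ltW (sP n)))// (le_trans _ Ne)// lef_pV2 ?posrE//.
      by rewrite ler_nat ltnS.
    by rewrite distrC (le_trans (ltW (sP N))).
  exists l => //; apply/eqP; rewrite -subr_eq0 -normr_le0.
  apply/ler_addgt0Pr => e e0; rewrite add0r.
  have e2 : 0 < e / 2 by rewrite divr_gt0.
  have eM : 0 < e / 2 / M by rewrite divr_gt0.
  move/cvgrPdist_le : sl => /(_ _ eM)[N1 _ sl].
  have [N2 N2e] := scalar_archi_inv e2.
  pose n := maxn N1 N2.
  rewrite -(subrKA (T (s n))) (le_trans (ler_normD _ _))// (splitr e) lerD//.
    rewrite -linB// (le_trans (TM _))// mulrC -ler_pdivlMr//.
    by apply: sl; rewrite /= leq_maxl.
  rewrite (le_trans (ltW (sP n)))// (le_trans _ N2e)// lef_pV2 ?posrE//.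
  by rewrite ler_nat ltnS leq_maxr.
pose S y : X := if pselect (exists x, T x = y) is left h then projT1 (cid h) else 0.
have ST x : S (T x) = x.
  rewrite /S; case: pselect => [h|h]; last by exfalso; apply: h; exists x.
  by case: cid => z /= /Tinj.
by exists S => //; exists c => _ [x _ <-]; rewrite ST.
Qed.

Lemma real_subsum N (a : nat -> R) : exists m : pred nat,
  \sum_(0 <= n < N) `|a n| <= 2 * `|\sum_(0 <= n < N) (if m n then a n else 0)|.
Proof.
pose P := \sum_(0 <= n < N) (if 0 <= a n then a n else 0).
pose Q := \sum_(0 <= n < N) (if ~~ (0 <= a n) then a n else 0).
have -> : \sum_(0 <= n < N) `|a n| = P - Q.
  rewrite /P /Q -sumrB; apply: eq_bigr => n _.
  case: (lerP 0 (a n)) => /= an; first by rewrite subr0 ger0_norm.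
  by rewrite sub0r ltr0_norm.
have P0 : 0 <= P by apply: sumr_ge0 => n _; case: ifP.
have Q0 : Q <= 0 by apply: sumr_le0 => n _; case: (lerP 0 (a n)) => //= /ltW.
have [PQ|/ltW PQ] := leP P (- Q).
  exists (fun n => ~~ (0 <= a n)); rewrite -/Q ler0_norm// mulr_natl mulr2n.
  by rewrite lerD.
exists (fun n => 0 <= a n); rewrite -/P ger0_norm// mulr_natl mulr2n.
by rewrite lerD.
Qed.

Lemma complex_norm_ge (z : complex R) :
  `|complex.Re z|%:C%C <= `|z| /\ `|complex.Im z|%:C%C <= `|z|.
Proof.
split; first exact: normc_ge_Re.
have -> : complex.Im z = - complex.Re (z * 'i%C) by rewrite ReiNIm opprK.
by rewrite normrN (le_trans (normc_ge_Re _))// normrM complexiE normCi mulr1.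
Qed.

(** Up to a constant, the $\ell^1$-norm is the largest modulus of a subsum;
    this is what allows countably many functionals with coefficients 0 and 1
    to be norming, over both fields. *)
Lemma scalar_subsum N (a : nat -> K) : exists m : pred nat,
  \sum_(0 <= n < N) `|a n| <= 4 * `|\sum_(0 <= n < N) (if m n then a n else 0)|.
Proof.
case: k a => a /=.
  have [m am] := real_subsum N a; exists m; rewrite (le_trans am)//.
  by rewrite ler_wpM2r// ler_nat.
have ReS (m : pred nat) : \sum_(0 <= n < N) (if m n then complex.Re (a n) else 0) =
    complex.Re (\sum_(0 <= n < N) (if m n then a n else 0)).
  rewrite (big_morph (@complex.Re R) (id1 := 0) (op1 := +%R))//; last by move=> [? ?] [].
  by apply: eq_bigr => n _; case: ifP.
have ImS (m : pred nat) : \sum_(0 <= n < N) (if m n then complex.Im (a n) else 0) =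
    complex.Im (\sum_(0 <= n < N) (if m n then a n else 0)).
  rewrite (big_morph (@complex.Im R) (id1 := 0) (op1 := +%R))//; last by move=> [? ?] [].
  by apply: eq_bigr => n _; case: ifP.
have [m1 am1] := real_subsum N (fun n => complex.Re (a n)).
have [m2 am2] := real_subsum N (fun n => complex.Im (a n)).
pose S m := \sum_(0 <= n < N) (if (m : pred nat) n then a n else 0).
have H : \sum_(0 <= n < N) `|a n| <= 2 * `|S m1| + 2 * `|S m2|.
  apply: (@le_trans _ _ (\sum_(0 <= n < N)
    (`|complex.Re (a n)|%:C%C + `|complex.Im (a n)|%:C%C))).
    by apply: ler_sum => n _; exact: complex_norm_le.
  rewrite big_split/= -!rmorph_sum.
  apply: lerD.
    apply: (@le_trans _ _ (2 * `|complex.Re (S m1)|)%:C%C).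
      by rewrite lecR -ReS.
    by rewrite rmorphM /= rmorph_nat ler_wpM2l//; exact: (complex_norm_ge _).1.
  apply: (@le_trans _ _ (2 * `|complex.Im (S m2)|)%:C%C).
    by rewrite lecR -ImS.
  by rewrite rmorphM /= rmorph_nat ler_wpM2l//; exact: (complex_norm_ge _).2.
have /orP[S12|S12] : (`|S m1| <= `|S m2|) || (`|S m2| <= `|S m1|).
- exact: (real_leVge (ger0_real _) (ger0_real _)).
- exists m2; rewrite (le_trans H)// -/(S m2).
  by rewrite (_ : 4 = 2 + 2) ?mulrDl ?lerD ?ler_wpM2l// -natrD.
- exists m1; rewrite (le_trans H)// -/(S m1).
  by rewrite (_ : 4 = 2 + 2) ?mulrDl ?lerD ?ler_wpM2l// -natrD.
Qed.

(** With coefficients 0 and 1 on finitely many coordinates there are only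
    countably many functionals, which can serve as the coordinates of a map into
    $\ell^\infty$. *)
Definition selection (s : seq (option nat)) (x : E) : K :=
  \sum_(0 <= n < size s)
    (if nth None s n is Some i then (x n : 'rV[K]_n.+1) ord0 (inord i) else 0).

Lemma selection_linear s a (x y : E) :
  selection s (a *: x + y) = a * selection s x + selection s y.
Proof.
rewrite /selection mulr_sumr -big_split; apply: eq_bigr => n _ /=.
by case: nth => [i|]; rewrite ?mulr0 ?addr0//= !mxE.
Qed.

Lemma selection_le s x : `|selection s x| <= `|x|.
Proof.
apply: le_trans (l1sum_partial_le x (size s)).
apply: le_trans (ler_norm_sum _ _ _) _; apply: ler_sum => n _.
by case: nth => [i|]; rewrite ?normr0// norm_rV_coord.
Qed.

Definition theta_coord (x : E) (j : nat) : K :=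
  if unpickle j is Some s then selection s x else 0.

Lemma theta_coord_linear j a (x y : E) :
  theta_coord (a *: x + y) j = a * theta_coord x j + theta_coord y j.
Proof.
rewrite /theta_coord; case: unpickle => [s|]; first exact: selection_linear.
by rewrite mulr0 addr0.
Qed.

Lemma theta_coord_le x j : `|theta_coord x j| <= `|x|.
Proof.
by rewrite /theta_coord; case: unpickle => [s|]; rewrite ?normr0// selection_le.
Qed.

Definition theta (x : E) : linfty k R :=
  Linfty (bounded_seqP (theta_coord_le x)).

Lemma theta_bounded : bounded_op theta.
Proof.
split; last first.
  by exists 1 => x; rewrite mul1r; apply: linfty_norm_le => j; exact: theta_coord_le.
by move=> a x y; apply: linfty_eq => j; exact: theta_coord_linear.
Qed.

Lemma theta_embedding : embedding theta.
Proof.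
apply: (@embedding_of_lower_bound _ _ theta 4) => // [|x]; first exact: theta_bounded.
pose i n := projT1 (cid (norm_rV_attained (x n : 'rV[K]_n.+1))).
have iP n : `|x n| = `|(x n : 'rV[K]_n.+1) ord0 (i n)| by rewrite /i; case: cid.
apply: l1sum_le => N.
have [m am] := scalar_subsum N (fun n => (x n : 'rV[K]_n.+1) ord0 (i n)).
rewrite (eq_bigr _ (fun n _ => iP n)) (le_trans am)// ler_wpM2l//.
pose s := mkseq (fun n => if m n then Some (nat_of_ord (i n)) else None) N.
apply: le_trans (linfty_norm_ge (theta x) (pickle s)).
rewrite /theta /= /theta_coord pickleK /selection size_mkseq.
rewrite le_eqVlt; apply/orP; left; apply/eqP; congr (`|_|).
apply: eq_big_nat => n /andP[_ nN]; rewrite nth_mkseq//.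
by case: (m n) => //; rewrite inord_val.
Qed.

End norming_embedding.

(** * $\ell^1$ contains no uniform copies of $\ell^\infty(n)$ *)

(** Hlawka's inequality $|x| + |y| + |z| + |x + y + z| \ge
    |x + y| + |y + z| + |z + x|$ for $x = a + b - c$, $y = a - b + c$ and
    $z = b + c - a$. *)
Definition four_term (F : numFieldType) (V : zmodType) (G : V -> F) :=
  (forall a b c, 2 * (G a + G b + G c) <=
  G (a + b + c) + G (a + b - c) + G (a - b + c) + G (b + c - a))%R.

Lemma cotype_constant (F : numFieldType) (x y z : F) :
  (x * (2 * y) * (z * 2) = x * (4 * y * z))%R.
Proof. by ring. Qed.

Lemma factor_constant (F : numFieldType) (a b x : F) : (a * b != 0)%R ->
  (a * ((2 * (a * b))^-1 * (b * x)) = x / 2)%R.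
Proof. by rewrite mulf_eq0 negb_or => /andP[a0 b0]; field; rewrite a0 b0. Qed.

Section cotype.
Local Open Scope ring_scope.
Variables (k : scalar_kind) (R : realType).
Local Notation K := (scalar_field k R).
Local Notation E := (l1sum_linfty k R).

(** Up to signs, $a, b, c \ge 0$; then the four terms on the right already add
    up to the left side without their moduli. *)
Lemma real_four_term (a b c : R) : 2 * (`|a| + `|b| + `|c|) <=
  `|a + b + c| + `|a + b - c| + `|a - b + c| + `|b + c - a|.
Proof.
have := ler_norm (a + b + c); have := ler_norm (a + b - c).
have := ler_norm (a - b + c); have := ler_norm (b + c - a).
have := ler_norm (- (a + b + c)); have := ler_norm (- (a + b - c)).
have := ler_norm (- (a - b + c)); have := ler_norm (- (b + c - a)).
rewrite !normrN; move: `|a + b + c| `|a + b - c| `|a - b + c| `|b + c - a|.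
by move=> ????; case: (ler0P a); case: (ler0P b); case: (ler0P c); lra.
Qed.

(** Over the complex numbers the sum of the moduli of the real and imaginary
    parts inherits the inequality from the reals. *)
Lemma scalar_four_term : exists p : K -> K,
  [/\ four_term p, forall z, `|z| <= p z & forall z, p z <= 2 * `|z|].
Proof.
case: k => /=.
  exists (fun z => `|z|); split => // z; first exact: real_four_term.
  by rewrite ler_peMl// ler1n.
exists (fun z => `|complex.Re z|%:C%C + `|complex.Im z|%:C%C); split.
- move=> [a a'] [b b'] [c c'] /=; rewrite -!rmorphD /=.
  rewrite -(rmorph_nat (real_complex R)) -rmorphM lecR.
  by have := real_four_term a b c; have := real_four_term a' b' c'; lra.
- exact: complex_norm_le.
- by move=> z; rewrite mulr_natl mulr2n lerD//; have [] := complex_norm_ge z.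
Qed.

(** One of the four signed sums is at least as large as their mean. *)
Lemma four_term_sign (V : lmodType K) (G : V -> K) : (forall v, 0 <= G v) ->
  four_term G -> forall a b c, exists s1 s2 s3 : bool,
  G a + G b + G c <= 2 * G ((-1) ^+ s1 *: a + ((-1) ^+ s2 *: b + (-1) ^+ s3 *: c)).
Proof.
move=> G0 G4 a b c; apply: contrapT => H.
have {}H (s1 s2 s3 : bool) :
    2 * G ((-1) ^+ s1 *: a + ((-1) ^+ s2 *: b + (-1) ^+ s3 *: c)) < G a + G b + G c.
  apply: pos_ltNge; rewrite ?addr_ge0 ?mulr_ge0//.
  by apply/negP => h; apply: H; exists s1, s2, s3.
have := ltrD (ltrD (ltrD (H false false false) (H false false true))
  (H false true false)) (H true false false).
rewrite !expr0 !expr1 !scale1r !scaleN1r -!mulrDr.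
have -> : G a + G b + G c + (G a + G b + G c) + (G a + G b + G c) + (G a + G b + G c)
  = 2 * (2 * (G a + G b + G c)) by ring.
rewrite ltr_pM2l// (_ : - a + (b + c) = b + c - a); last exact: addrC.
by rewrite !addrA => /(le_lt_trans (G4 a b c)); rewrite ltxx.
Qed.

(** Signs are chosen within three blocks of $3^m$ vectors first and then for the
    three resulting sums, which gains a factor $3/2$ over the average. *)
Lemma sign_growth (V : lmodType K) (G : V -> K) : (forall v, 0 <= G v) ->
  four_term G -> forall m (x : nat -> V), exists s : nat -> bool,
  \sum_(0 <= i < 3 ^ m) G (x i) <= 2 ^+ m * G (\sum_(0 <= i < 3 ^ m) (-1) ^+ s i *: x i).
Proof.
move=> G0 G4; elim=> [|m IH] x.
  by exists (fun=> false); rewrite !expn0 !big_nat1 !expr0 scale1r mul1r.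
pose N := (3 ^ m)%N.
have split3 (W : nmodType) (F : nat -> W) : \sum_(0 <= i < 3 ^ m.+1) F i =
    \sum_(0 <= i < N) F i + (\sum_(0 <= i < N) F (i + N)%N +
      \sum_(0 <= i < N) F (i + (N + N))%N).
  have -> : (3 ^ m.+1 = N + (N + N))%N by rewrite expnS !mulSn mul0n addn0.
  rewrite (big_cat_nat (n := N)) ?leq_addr//=; congr (_ + _).
  rewrite (big_cat_nat (n := N + N)%N) ?leq_addr ?leq_add2l ?leq_addl//=.
  have shift a : \sum_(a <= i < N + a) F i = \sum_(0 <= i < N) F (i + a)%N.
    by rewrite -{1}[a]add0n big_addn addnK.
  by rewrite !shift.
have [s1 h1] := IH x; have [s2 h2] := IH (fun i => x (i + N)%N).
have [s3 h3] := IH (fun i => x (i + (N + N))%N).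
rewrite -/N in h1 h2 h3.
set y1 := (X in G X) in h1; set y2 := (X in G X) in h2.
set y3 := (X in G X) in h3.
have [e1 [e2 [e3 H]]] := four_term_sign G0 G4 y1 y2 y3.
exists (fun i => if (i < N)%N then e1 (+) s1 i else
  if (i < N + N)%N then e2 (+) s2 (i - N)%N else e3 (+) s3 (i - (N + N))%N).
rewrite !split3 (le_trans (lerD h1 (lerD h2 h3)))// -!mulrDr exprSr -mulrA.
rewrite ler_wpM2l ?exprn_ge0// addrA (le_trans H)//.
rewrite le_eqVlt; apply/orP; left; apply/eqP; congr (2 * G (_ + (_ + _))).
- rewrite scaler_sumr; apply: eq_big_nat => i /andP[_ iN].
  by rewrite iN signr_addb scalerA.
- rewrite scaler_sumr; apply: eq_big_nat => i /andP[_ iN].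
  by rewrite ltnNge leq_addl /= ltn_add2r iN addnK signr_addb scalerA.
- rewrite scaler_sumr; apply: eq_big_nat => i /andP[_ iN].
  rewrite ltnNge (leq_trans (leq_addl N N)) ?leq_addl//=.
  by rewrite ltnNge leq_addl /= addnK signr_addb scalerA.
Qed.

(** Coordinates come from a sequence indexed by natural numbers, so that families
    of vectors in different summands need no casts. *)
Definition block n (a : nat -> K) : E :=
  @l1_single k R (fun n => 'rV[K]_n.+1) n (\row_(j < n.+1) a j).

Lemma block_le n a (c : K) : 0 <= c -> (forall i, `|a i| <= c) -> `|block n a| <= c.
Proof.
move=> c0 ac; apply: le_trans (l1_single_le _) _.
by apply: norm_rV_le => // i; rewrite mxE.
Qed.

Lemma block_sum n I (r : seq I) (c : I -> K) (a : I -> nat -> K) :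
  \sum_(i <- r) c i *: block n (a i) = block n (fun j => \sum_(i <- r) c i * a i j).
Proof.
rewrite /block -(eq_bigr _ (fun i _ => linZ (@l1_single_linear _ _ _ n) _ _)).
rewrite -(lin_sum (@l1_single_linear _ _ _ n)); congr l1_single.
by apply/rowP => j; rewrite summxE mxE; apply: eq_bigr => i _; rewrite !mxE.
Qed.

Lemma block_delta_sum n m (c : nat -> K) :
  \sum_(0 <= i < m) c i *: block n (fun j => (j == i)%:R) =
  block n (fun j => if (j < m)%N then c j else 0).
Proof.
rewrite block_sum; congr block; apply/funext => j.
case: ltnP => jm; last first.
  rewrite big1_seq// => i; rewrite mem_index_iota => /andP[_ /andP[_ im]].
  by rewrite gtn_eqF ?mulr0// (leq_trans im jm).
rewrite (bigD1_seq j) ?mem_index_iota ?iota_uniq//= eqxx mulr1 big1 ?addr0//.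
by move=> i ij; rewrite eq_sym (negPf ij) mulr0.
Qed.

Lemma block_delta_ge n i : (i <= n)%N -> 1 <= `|block n (fun j => (j == i)%:R)|.
Proof.
move=> ni; apply: le_trans (l1sum_coord_le _ n).
rewrite /block l1_single_same; apply: le_trans (norm_rV_coord _ (inord i)).
by rewrite mxE inordK ?ltnS// eqxx normr1.
Qed.

(** A consequence of the cotype 2 property of $\ell^1$: the images of the unit
    coordinate vectors of $\ell^\infty(n)$ would have long signed sums, whereas
    those of the vectors themselves have norm 1. *)
Lemma no_embedding_in_l1 (T : E -> l1 k R) (c : K) : bounded_op T -> 0 < c ->
  ~ (forall x, `|x| <= c * `|T x|).
Proof.
move=> bT c0 cT; have [linT _] := bT; have [M M0 TM] := bounded_opP bT.
have [p [p4 p1 p2]] := scalar_four_term.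
suff H m : 3 ^+ m <= 2 ^+ m * (4 * M * c).
  have [|n nM] := @scalar_archi k R (2 * (4 * M * c) + 1).
    by rewrite addr_ge0// ?mulr_ge0// ltW.
  have n3 m : (m * 2 ^ m <= 2 * 3 ^ m)%N.
    elim: m => // m; rewrite !expnS => IH.
    have : (2 ^ m <= 3 ^ m)%N by case: m {IH} => // m; rewrite leq_exp2r.
    by nia.
  have nC : n%:R * 2 ^+ n <= 2 * (4 * M * c) * 2 ^+ n :> K.
    rewrite -mulrA [in leRHS](mulrC _ (2 ^+ n)).
    apply: (@le_trans _ _ (2 * 3 ^+ n)); last by rewrite ler_wpM2l.
    by rewrite -!natrX -!natrM ler_nat.
  rewrite ler_pM2r ?exprn_gt0// in nC.
  by have := le_trans nM nC; rewrite gerDl ler10.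
pose N := (3 ^ m)%N.
pose e i : E := block N (fun j => (j == i)%:R).
have Te i : (i < N)%N -> c^-1 <= `|T (e i)|.
  move=> iN; rewrite -[leLHS]mulr1 ler_pdivrMl//.
  by rewrite (le_trans _ (cT _))// block_delta_ge// ltnW.
have c2 : 0 < c^-1 / 2 by rewrite divr_gt0// invr_gt0.
have [t tP] := choice (fun i => l1_tail_small (T (e i)) c2).
pose t0 := \max_(i < N) t i.
(* Finitely many coordinates carry half the norm of each of these vectors, so a
   finite sum can replace the norm. *)
pose G (y : l1 k R) := \sum_(0 <= j < t0) p (y j).
have p0 z : 0 <= p z by apply: le_trans (p1 z).
have G0 y : 0 <= G y by apply: sumr_ge0.
have G4 : four_term G.
  move=> a b d; rewrite /G -!big_split mulr_sumr /= ; apply: ler_sum => j _.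
  exact: p4.
have G2 y : G y <= 2 * `|y|.
  rewrite (le_trans (ler_sum _ (fun j _ => p2 (y j))))// -mulr_sumr ler_wpM2l//.
  exact: l1sum_partial_le.
have Ge i : (i < N)%N -> c^-1 / 2 <= G (T (e i)).
  move=> iN; have tt : (t i <= t0)%N.
    exact: (@leq_bigmax _ (fun i : 'I_N => t i) (Ordinal iN)).
  apply: (@le_trans _ _ (\sum_(0 <= j < t0) `|T (e i) j|)); last first.
    by apply: ler_sum => j _.
  apply: le_trans (l1_restrict_interval_le _ _ _).
  have := Te i iN; rewrite -{1}(l1_restrict_id (fun n => (n < t0)%N) (T (e i))).
  move=> /le_trans/(_ (ler_normD _ _)) /le_trans/(_ (lerD (lexx _) (tP i t0 tt))).
  by rewrite {1}(splitr c^-1) lerD2r.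
have [s sP] := sign_growth G0 G4 m (fun i => T (e i)).
have H1 : 3 ^+ m * (c^-1 / 2) <= \sum_(0 <= i < 3 ^ m) G (T (e i)).
  rewrite -natrX -/N mulr_natl -[X in _ *+ X]subn0 -sumr_const_nat.
  by rewrite ler_sum_nat// => i /andP[_]; exact: Ge.
have H2 : G (\sum_(0 <= i < 3 ^ m) (-1) ^+ s i *: T (e i)) <= 2 * M.
  rewrite -(eq_bigr _ (fun i _ => linZ linT _ _)) -(lin_sum linT).
  rewrite (le_trans (G2 _))// ler_wpM2l// (le_trans (TM _))// ler_piMr ?(ltW M0)//.
  rewrite block_delta_sum block_le// => i; case: ifP => _; last by rewrite normr0.
  by rewrite normrX normrN1 expr1n.
have := le_trans H1 (le_trans sP (ler_wpM2l (exprn_ge0 m (ler0n _ 2)) H2)).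
rewrite -ler_pdivlMr// => /le_trans; apply.
rewrite le_eqVlt; apply/orP; left; apply/eqP.
by rewrite invfM !invrK; exact: cotype_constant.
Qed.

(** If $1 = ATB$ then $\theta TB$ is bounded below, and so is every operator close
    to it, in particular one that factors through $\ell^1$; its first factor is
    then bounded below. *)
Lemma Gi_not_factor_id (T A B : E -> E) : Gi_l1 T -> bounded_op A -> bounded_op B ->
  A \o T \o B <> idfun.
Proof.
move=> [bT [th [bth _ [S thS [m Sm]]] [_ Hc]]] bA bB ATB.
have [a a0 Aa] := bounded_opP bA; have [b b0 Bb] := bounded_opP bB.
pose m' := `|m| + 1; have m0 : 0 < m' by rewrite ltr_wpDl.
have thm x : `|x| <= m' * `|th x|.
  have [->|x0] := eqVneq x 0; first by rewrite normr0 mulr_ge0// ltW.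
  have := Sm (th x) (ex_intro2 _ _ x I erefl); rewrite thS => xm.
  have thx : 0 < `|th x|.
    rewrite normr_gt0; apply: contraNneq x0 => th0.
    by move: xm; rewrite th0 normr0 mulr0 normr_le0.
  have m1 : 0 <= m by rewrite -(pmulr_lge0 _ thx) (le_trans _ xm).
  by rewrite (le_trans xm)// ler_pM2r// /m' ger0_norm// lerDl.
have d0 : 0 < (2 * (a * m' * b))^-1 by rewrite invr_gt0 !mulr_gt0.
have [V [U [W [bU bW VE]]] Vd] := Hc _ d0.
have [w w0 Ww] := bounded_opP bW.
have bV : bounded_op V by rewrite VE; exact: bounded_comp.
have bD := bounded_sub (bounded_comp bth bT) bV.
apply: (@no_embedding_in_l1 (U \o B) (2 * (a * m' * w)) (bounded_comp bU bB)).
  by rewrite !mulr_gt0.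
move=> x /=; rewrite -mulrA.
have H1 : `|x| <= a * m' * `|th (T (B x))|.
  have -> : `|x| = `|A (T (B x))| by congr (`|_|); exact: (congr1 (@^~ x) (esym ATB)).
  by rewrite (le_trans (Aa _))// -mulrA ler_pM2l.
have H2 : `|th (T (B x))| <= w * `|U (B x)| + (2 * (a * m' * b))^-1 * (b * `|x|).
  rewrite -(subrK (V (B x)) (th _)) addrC (le_trans (ler_normD _ _))// lerD//.
    by rewrite VE /= Ww.
  rewrite (le_trans (opnorm_ge bD (B x)))//.
  by rewrite (le_trans (ler_wpM2r _ (ltW Vd)))// ler_pM2l.
have := le_trans H1 (ler_wpM2l (ltW (mulr_gt0 a0 m0)) H2).
rewrite mulrDr [X in _ + X](_ : _ = `|x| / 2).
  by rewrite -lerBlDr {1}(splitr `|x|) addrK ler_pdivrMr// mulrC !mulrA.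
by apply: factor_constant; rewrite !mulf_neq0 ?lt0r_neq0.
Qed.

End cotype.

(** * Order bounded operators *)

Section order_bounded.
Local Open Scope ring_scope.
Variables (k : scalar_kind) (R : realType).
Local Notation K := (scalar_field k R).
Local Notation E := (l1sum_linfty k R).
Local Notation Esingle n v := (@l1_single k R (fun n => 'rV[K]_n.+1) n v).

Definition entry (T : E -> E) n j i : K :=
  theta_coord (T (block n (fun l => (l == i)%:R))) j.

(** The intrinsic form of membership in $\mathcal{G}^i_{\ell^1}(E)$: it does not
    refer to factorizations and is visibly stable under sums. *)
Definition order_bounded (T : E -> E) := forall e : K, 0 < e ->
  exists C : K, forall n, exists g : nat -> K,
  [/\ forall i, 0 <= g i, \sum_(0 <= i < n.+1) g i <= C &
      forall j, exists b : nat -> K, \sum_(0 <= i < n.+1) `|b i| <= e /\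
        forall i, `|entry T n j i - b i| <= g i].

Lemma order_bounded_add S T : order_bounded S -> order_bounded T ->
  order_bounded (fun x => S x + T x).
Proof.
move=> bS bT e e0; have e2 : 0 < e / 2 by rewrite divr_gt0.
have [C1 h1] := bS _ e2; have [C2 h2] := bT _ e2.
exists (C1 + C2) => n; have [g1 [g10 g1C h1']] := h1 n.
have [g2 [g20 g2C h2']] := h2 n; exists (fun i => g1 i + g2 i); split.
- by move=> i; rewrite addr_ge0.
- by rewrite big_split lerD.
move=> j; have [b1 [b1e hb1]] := h1' j; have [b2 [b2e hb2]] := h2' j.
exists (fun i => b1 i + b2 i); split.
  rewrite (splitr e); apply: le_trans (lerD b1e b2e).
  by rewrite -big_split ler_sum// => i _; exact: ler_normD.
move=> i; rewrite (_ : entry _ n j i = entry S n j i + entry T n j i).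
  by rewrite opprD addrACA (le_trans (ler_normD _ _))// lerD.
by rewrite /entry -[in LHS](scale1r (S _)) theta_coord_linear mul1r.
Qed.

Lemma order_bounded0 : order_bounded (fun=> 0).
Proof.
move=> e e0; exists 0 => n; exists (fun=> 0); split => //.
  by rewrite big1.
move=> j; exists (fun=> 0); split; first by rewrite big1 ?ltW// => i _; rewrite normr0.
move=> i; rewrite /entry subr0.
have := theta_coord_linear j (-1) (0 : E) 0.
by rewrite scaleN1r addNr mulN1r addNr => ->; rewrite normr0.
Qed.

Lemma block_coordE n (v : 'rV[K]_n.+1) :
  Esingle n v =
  \sum_(0 <= i < n.+1) v ord0 (inord i) *: block n (fun l => (l == i)%:R).
Proof.
rewrite block_delta_sum /block; congr (@l1_single _ _ _ n _).
by apply/rowP => j; rewrite mxE ltn_ord inord_val.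
Qed.

Lemma linfty_sum_app I (r : seq I) (F : I -> linfty k R) j :
  (\sum_(i <- r) F i) j = \sum_(i <- r) F i j.
Proof. exact: (big_morph (fun x : linfty k R => x j)). Qed.

(** An order bounded matrix is the diagonal multiplication by the bound,
    which maps $E$ to $\ell^1$, followed by a matrix with entries of modulus
    at most 1. *)
Lemma order_bounded_Gi T : bounded_op T -> order_bounded T -> Gi_l1 T.
Proof.
move=> bT obT; split => //; exists (@theta k R); first exact: theta_embedding.
have [linT _] := bT; have bth := theta_bounded k R.
split=> [|e e0]; first exact: bounded_comp.
have e2 : 0 < e / 2 by rewrite divr_gt0.
have [C h] := obT _ e2; have {h}[g h] := choice h.
have g0 n i : 0 <= g n i by have [] := h n.
have gC n : \sum_(0 <= i < n.+1) g n i <= C by have [] := h n.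
have hb n j : exists b : nat -> K, \sum_(0 <= i < n.+1) `|b i| <= e / 2 /\
    forall i, `|entry T n j i - b i| <= g n i by have [] := h n.
pose b n j := projT1 (cid (hb n j)).
have bP n j : \sum_(0 <= i < n.+1) `|b n j i| <= e / 2 /\
    forall i, `|entry T n j i - b n j i| <= g n i by rewrite /b; case: cid.
have C0 : 0 <= C by apply: le_trans (gC 0%N); apply: sumr_ge0.
pose dl1 t : l1 k R := @l1_single k R (fun=> K) t 1.
have dl1_le t : `|dl1 t| <= 1 by rewrite (le_trans (l1_single_le _))// normr1.
pose phi n (v : 'rV[K]_n.+1) : l1 k R :=
  \sum_(0 <= i < n.+1) (g n i * v ord0 (inord i)) *: dl1 (pickle (n, i)).
have [||U [bU _ UE]] := @l1sum_lift k R (fun n => 'rV[K]_n.+1) (l1 k R) phi C C0.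
- move=> n a u v; rewrite /phi scaler_sumr -big_split; apply: eq_bigr => i _ /=.
  by rewrite !mxE mulrDr mulrCA scalerDl scalerA.
- move=> n v; rewrite /phi (le_trans (ler_norm_sum _ _ _))//.
  apply: (@le_trans _ _ ((\sum_(0 <= i < n.+1) g n i) * `|v|)); last first.
    by rewrite ler_wpM2r.
  rewrite mulr_suml; apply: ler_sum => i _.
  rewrite normrZ -[leRHS]mulr1 ler_pM// normrM (ger0_norm (g0 _ _)).
  by rewrite ler_wpM2l// norm_rV_coord.
pose q t j : K := if unpickle t is Some (n, i) then
  (entry T n j i - b n j i) / g n i else 0.
have q1 t j : `|q t j| <= 1.
  rewrite /q; case: unpickle => [[n i]|]; last by rewrite normr0.
  have [_ /(_ i)] := bP n j; rewrite normrM normfV (ger0_norm (g0 _ _)).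
  have [->|gn0] := eqVneq (g n i) 0; first by rewrite invr0 mulr0.
  by rewrite ler_pdivrMr ?mul1r// lt0r gn0 g0.
pose Q t : linfty k R := Linfty (bounded_seqP (q1 t)).
have [||S [bS _ SE]] := @l1sum_lift k R (fun=> K) (linfty k R) (fun t z => z *: Q t) 1 ler01.
- by move=> t a u v; rewrite scalerDl scalerA.
- move=> t z; rewrite normrZ mul1r ler_piMr//.
  exact: (@linfty_norm_le _ _ (Q t) 1 (q1 t)).
exists (S \o U); first by exists U, S.
have bD := bounded_sub (bounded_comp bth bT) (bounded_comp bS bU).
apply: (@le_lt_trans _ _ (e / 2)); last by rewrite gtr_pMr// invf_lt1// ltr1n.
apply: opnorm_le => //; first exact: ltW.
apply: l1sum_op_le => //; first exact: ltW.
move=> n v; have [linD _] := bD; have [linS _] := bS.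
apply: linfty_norm_le => j.
have -> : ((@theta k R \o T) \- (S \o U)) (Esingle n v) j =
    \sum_(0 <= i < n.+1) (v : 'rV[K]_n.+1) ord0 (inord i) * b n j i.
  have -> : ((@theta k R \o T) \- (S \o U)) (Esingle n v) j =
    theta (T (Esingle n v)) j - S (U (Esingle n v)) j by [].
  rewrite UE block_coordE (lin_sum linT) (lin_sum bth.1) (lin_sum linS).
  rewrite !linfty_sum_app -sumrB; apply: eq_bigr => i _.
  rewrite (linZ linT) (linZ bth.1) (linZ linS) SE scale1r.
  rewrite [X in X - _](_ : _ = v ord0 (inord i) * entry T n j i)//.
  rewrite [X in _ - X](_ : _ = g n i * v ord0 (inord i) * q (pickle (n, i)) j)//.
  rewrite /q pickleK (mulrC (g n i)) -mulrA -mulrBr; congr (_ * _).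
  have [g_0|gn0] := eqVneq (g n i) 0; last by rewrite mulrC divfK// subKr.
  have [_ /(_ i)] := bP n j; rewrite g_0 normr_le0 subr_eq0 => /eqP ->.
  by rewrite mul0r subr0.
rewrite (le_trans (ler_norm_sum _ _ _))//.
apply: (@le_trans _ _ ((\sum_(0 <= i < n.+1) `|b n j i|) * `|v|)); last first.
  by rewrite ler_wpM2r//; have [] := bP n j.
rewrite mulr_suml; apply: ler_sum => i _.
by rewrite normrM mulrC ler_wpM2l// norm_rV_coord.
Qed.

End order_bounded.

(** * Rows of operators that are not order bounded *)

Section sparse.

(** A directed graph of out-degree at most [D] contains large subsequences
    without forward edges: keep the head, drop its successors, repeat. *)
Lemma sparse_subseq (bad : rel nat) D L (s : seq nat) :
  (L * D.+1 <= size s)%N -> (forall x, x \in s -> (count (bad x) s <= D)%N) ->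
  exists t, [/\ subseq t s, size t = L & pairwise (fun x y => ~~ bad x y) t].
Proof.
elim: L s => [|L IH] s; first by exists [::]; rewrite sub0seq.
case: s => [//|x s] sL sD.
have [||t [ts tL tp]] := IH [seq y <- s | ~~ bad x y].
- have := sD x (mem_head _ _); rewrite /= => xD.
  rewrite size_filter -(leq_add2l (count (bad x) s)) count_predC.
  rewrite mulSn /= addSn ltnS in sL; apply: leq_trans sL.
  by rewrite leq_add2r (leq_trans _ xD)// leq_addl.
- move=> y; rewrite mem_filter => /andP[_ ys].
  apply: leq_trans (sD y _); last by rewrite inE ys orbT.
  apply: (@leq_trans (count (bad y) s)); last by rewrite /= leq_addl.
  exact: leq_count_subseq _ (filter_subseq _ _).
exists (x :: t); split=> /=.
- by rewrite eqxx (subseq_trans ts)// filter_subseq.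
- by rewrite tL.
- rewrite tp andbT; apply/allP => y /(mem_subseq ts).
  by rewrite mem_filter => /andP[].
Qed.

End sparse.

Section not_order_bounded.
Local Open Scope ring_scope.
Variables (k : scalar_kind) (R : realType).
Local Notation K := (scalar_field k R).
Local Notation E := (l1sum_linfty k R).

(** These are the images of the unit vectors under the contractions from
    $\ell^\infty(N)$. *)
Definition spread N (u : nat -> E) := forall a : nat -> K,
  (forall i, `|a i| <= 1) -> `|\sum_(0 <= i < N) a i *: u i| <= 1.

(** Division by zero makes the phase of 0 equal to 0. *)
Definition phase (z : K) := `|z| / z.

Lemma phase_le1 z : `|phase z| <= 1.
Proof.
rewrite /phase normrM normfV normr_id.
by have [->|z0] := eqVneq z 0; rewrite ?normr0 ?mul0r// divff// normr_eq0.
Qed.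

Lemma phaseM z : phase z * z = `|z|.
Proof.
rewrite /phase; have [->|z0] := eqVneq z 0; first by rewrite mulr0 normr0.
by rewrite divfK.
Qed.

(** A functional has on such vectors the values of a functional on
    $\ell^\infty(N)$, hence of a vector in $\ell^1(N)$. *)
Lemma spread_dual N u (h : E -> K) (M : K) : spread N u ->
  (forall a x y, h (a *: x + y) = a * h x + h y) -> (forall x, `|h x| <= M * `|x|) ->
  0 <= M -> \sum_(0 <= i < N) `|h (u i)| <= M.
Proof.
move=> su linh hM M0; pose a i := phase (h (u i)).
have linh' : linear (h : E -> K^o) by move=> b x y; exact: linh.
have -> : \sum_(0 <= i < N) `|h (u i)| = h (\sum_(0 <= i < N) a i *: u i).
  rewrite (lin_sum linh'); apply: eq_bigr => i _.
  by rewrite (linZ linh') -phaseM.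
have := hM (\sum_(0 <= i < N) a i *: u i).
rewrite (lin_sum linh') ger0_norm; last first.
  by apply: sumr_ge0 => i _; rewrite (linZ linh') /GRing.scale /= phaseM.
move=> /le_trans; apply; rewrite ler_piMr//; apply: su => i; exact: phase_le1.
Qed.

Lemma count_large N (a : nat -> K) (M d : K) D : (forall i, 0 <= a i) ->
  \sum_(0 <= i < N) a i <= M -> 0 < d -> M <= d * D%:R ->
  (count (fun i => ~~ (a i <= d)%R) (iota 0 N) <= D)%N.
Proof.
move=> a0 aM d0 MD; rewrite -(ler_nat K) -(ler_pM2l d0).
apply: le_trans MD; apply: le_trans aM.
rewrite -sum1_count natr_sum mulr_sumr /index_iota subn0 big_mkcond.
apply: ler_sum => i _; case: ifP => // /(pos_ltNge (a0 i) (ltW d0)) /ltW.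
by rewrite mulr1.
Qed.

Lemma block_deltaE n (a : nat -> K) :
  block n a = \sum_(0 <= i < n.+1) a i *: block n (fun l => (l == i)%:R) :> E.
Proof.
rewrite block_delta_sum /block; congr (l1_single _).
by apply/rowP => i; rewrite !mxE ltn_ord.
Qed.

Lemma spread_delta n : spread n.+1 (fun i => block n (fun l => (l == i)%:R)).
Proof.
move=> a a1; rewrite -block_deltaE; exact: block_le.
Qed.

Section fixed_operator.
Variables (T : E -> E) (M : K).
Hypotheses (linT : linear T) (M0 : 0 < M) (TM : forall x, `|T x| <= M * `|x|).

Let row j (x : E) := theta_coord (T x) j.

Let row_linear j a x y : row j (a *: x + y) = a * row j x + row j y.
Proof. by rewrite /row linT theta_coord_linear. Qed.

Let row_le j x : `|row j x| <= M * `|x|.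
Proof. exact: le_trans (theta_coord_le _ _) (TM _). Qed.

Lemma entry_sum_le n j : \sum_(0 <= i < n.+1) `|entry T n j i| <= M.
Proof.
exact: (spread_dual (spread_delta n) (row_linear j) (row_le j) (ltW M0)).
Qed.

Lemma theta_coord_block n j (a : nat -> K) :
  theta_coord (T (block n a)) j = \sum_(0 <= i < n.+1) a i * entry T n j i.
Proof.
have linr : linear (row j : E -> K^o) by move=> b x y; exact: row_linear.
rewrite -/(row j _) block_deltaE (lin_sum linr).
by apply: eq_bigr => i _; rewrite (linZ linr).
Qed.

(** The part of a row on which it stays below [g] can be left to the order
    interval, so the failure of the bound is a statement about the remaining
    part. *)
Lemma not_order_bounded_escape : ~ order_bounded T -> exists2 e : K, 0 < e &
  forall C : K, exists n, forall g : nat -> K, (forall i, 0 <= g i) ->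
  \sum_(0 <= i < n.+1) g i <= C -> exists j,
  e < \sum_(0 <= i < n.+1) (if `|entry T n j i| <= g i then 0 else `|entry T n j i|).
Proof.
move=> nob; apply: contrapT => H; apply: nob => e e0.
apply: contrapT => /forallNP Hc; apply: H; exists e => // C.
apply: contrapT => /forallNP Hn; apply: (Hc C) => n.
have /existsNP[g /not_implyP[g0 /not_implyP[gC /forallNP Hj]]] := Hn n.
exists g; split => // j.
exists (fun i => if `|entry T n j i| <= g i then 0 else entry T n j i); split.
  have /negP := Hj j; rewrite -real_leNgt; last 2 first.
  - by rewrite ger0_real// sumr_ge0// => i _; case: ifP.
  - by rewrite ger0_real// ltW.
  apply: le_trans; apply: ler_sum => i _; case: ifP => //.
  by rewrite normr0.
by move=> i; case: ifP => // h; rewrite ?subr0// subrr normr0.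
Qed.

Definition escape n (lam : K) (J : nat -> nat) l := \sum_(0 <= i < n.+1)
  (if `|entry T n (J l) i| <= lam * \sum_(0 <= m < l) `|entry T n (J m) i|
   then 0 else `|entry T n (J l) i|).

Lemma escape_ext n lam (J J' : nat -> nat) l :
  (forall m, (m <= l)%N -> J m = J' m) -> escape n lam J l = escape n lam J' l.
Proof.
move=> JJ; apply: eq_bigr => i _; rewrite JJ//.
rewrite (_ : \sum_(0 <= m < l) _ = \sum_(0 <= m < l) `|entry T n (J' m) i|)//.
by apply: eq_big_nat => m /andP[_ ml]; rewrite JJ// ltnW.
Qed.

(** The order interval spanned by [lam] times the sum of the rows found so far has
    bounded length, so some further row escapes from it. *)
Lemma escaping_rows n (lam e : K) N : 0 <= lam ->
  (forall g : nat -> K, (forall i, 0 <= g i) ->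
   \sum_(0 <= i < n.+1) g i <= lam * (M *+ N) -> exists j,
   e < \sum_(0 <= i < n.+1) (if `|entry T n j i| <= g i then 0 else `|entry T n j i|)) ->
  exists J : nat -> nat, forall l, (l < N)%N -> e < escape n lam J l.
Proof.
move=> lam0 H.
suff : forall N', (N' <= N)%N ->
    exists J : nat -> nat, forall l, (l < N')%N -> e < escape n lam J l.
  by move=> /(_ N (leqnn N)).
elim=> [_|N' IH NN]; first by exists (fun=> 0%N).
have [J HJ] := IH (ltnW NN).
have [||j jP] := H (fun i => lam * \sum_(0 <= m < N') `|entry T n (J m) i|).
- by move=> i; rewrite mulr_ge0// sumr_ge0.
- rewrite -mulr_sumr ler_wpM2l// exchange_big /=.
  apply: (@le_trans _ _ (\sum_(0 <= m < N') M)).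
    by apply: ler_sum => m _; exact: entry_sum_le.
  by rewrite sumr_const_nat subn0 -![M *+ _]mulr_natl ler_wpM2r ?(ltW M0)// ler_nat ltnW.
exists (fun l => if (l < N')%N then J l else j) => l.
rewrite ltnS leq_eqVlt => /orP[/eqP ->|lN].
  rewrite /escape ltnn; apply: lt_le_trans jP _; apply: ler_sum => i _.
  rewrite (_ : \sum_(0 <= m < N') `|entry T n (if _ then _ else _) i| =
    \sum_(0 <= m < N') `|entry T n (J m) i|)//.
  by apply: eq_big_nat => m /andP[_ ->].
rewrite (@escape_ext _ _ _ J) ?HJ// => m ml.
by rewrite (leq_ltn_trans ml lN).
Qed.

(** If the multiple is large, the preceding rows are negligible where a row
    escapes. Remove from the set where the $l$-th row escapes those of the later
    rows: the remaining sets are disjoint and still carry half of the mass. *)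
Lemma disjoint_carriers : ~ order_bounded T -> exists2 rho : K, 0 < rho &
  forall N (tau : K), 0 < tau -> exists (u : nat -> E) (J : nat -> nat),
  [/\ spread N u,
      forall l, (l < N)%N -> rho <= `|theta_coord (T (u l)) (J l)| &
      forall l m, (l < m)%N -> (m < N)%N ->
        `|theta_coord (T (u m)) (J l)| <= tau].
Proof.
move=> nob; have [e e0 He] := not_order_bounded_escape nob.
have r0 : 0 < e / 2 by rewrite divr_gt0.
exists (e / 2) => // N tau0 tau0_gt0.
have [tau [t0 t_le Nt]] : exists tau : K,
    [/\ 0 < tau, tau <= tau0 & N%:R * tau <= e / 2].
  have d0 : 0 < e / 2 + N%:R * tau0 by rewrite ltr_wpDr// mulr_ge0// ltW.
  exists (tau0 * (e / 2) / (e / 2 + N%:R * tau0)); split.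
  - by rewrite divr_gt0// mulr_gt0.
  - by rewrite ler_pdivrMr// ler_pM2l// lerDl mulr_ge0// ltW.
  - rewrite !mulrA -[_ * e / 2]mulrA ler_pdivrMr// mulrC ler_pM2l//.
    by rewrite lerDr ltW.
(* Where one row exceeds [lam] times another, the mass of the latter is at most
   [M / lam], which is [tau]. *)
pose lam := M / tau; have lam0 : 0 < lam by rewrite divr_gt0.
have [n Hn] := He (lam * (M *+ N)).
have [J HJ] := escaping_rows (ltW lam0) Hn.
pose w l i := entry T n (J l) i.
pose A l i := ~~ (`|w l i| <= lam * \sum_(0 <= m < l) `|w m i|).
pose B l i := A l i && ~~ has (A ^~ i) (index_iota l.+1 N).
pose u l := block n (fun i => if B l i then phase (w l i) else 0).
have Bdisj l m i : (l < m)%N -> (m < N)%N -> B l i -> B m i -> False.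
  move=> lm mN /andP[_ /hasPn Bl] /andP[Am _].
  by have := Bl m; rewrite mem_index_iota lm mN Am => /(_ isT).
have Asmall l m : (l < m)%N ->
    \sum_(0 <= i < n.+1) (if A m i then `|w l i| else 0) <= tau.
  move=> lm; have -> : tau = lam^-1 * M.
    by rewrite /lam invfM invrK mulrAC mulVf ?mul1r// lt0r_neq0.
  apply: le_trans (ler_wpM2l _ (entry_sum_le n (J m))); last first.
    by rewrite invr_ge0 ltW.
  rewrite mulr_sumr; apply: ler_sum => i _; case: ifP; last first.
    by rewrite mulr_ge0// invr_ge0 ltW.
  have S0 : 0 <= lam * \sum_(0 <= m0 < m) `|w m0 i|.
    by rewrite mulr_ge0// ?sumr_ge0// ltW.
  move=> /(pos_ltNge (normr_ge0 _) S0) /ltW /(le_trans _) H.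
  rewrite ler_pdivlMl//; apply: H; rewrite ler_pM2l//.
  rewrite (bigD1_seq l) ?mem_index_iota ?iota_uniq//= lerDl.
  by rewrite sumr_ge0.
have uE l j : theta_coord (T (u l)) j =
    \sum_(0 <= i < n.+1) (if B l i then phase (w l i) * entry T n j i else 0).
  rewrite theta_coord_block; apply: eq_bigr => i _.
  by case: ifP => //; rewrite mul0r.
exists u, J; split.
- move=> a a1; rewrite block_sum; apply: block_le => // i.
  have [[l [lN Bl]]|noB] := pselect (exists l, (l < N)%N /\ B l i); last first.
    rewrite big1_seq ?normr0// => l; rewrite mem_index_iota => /andP[_ lN].
    by case: ifP; rewrite ?mulr0// => Bl; case: noB; exists l.
  rewrite (bigD1_seq l) ?mem_index_iota ?iota_uniq//= Bl big1_seq ?addr0.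
    by rewrite normrM mulr_ile1// phase_le1.
  move=> m; rewrite mem_index_iota => /andP[ml mN].
  case: ifP; rewrite ?mulr0// => Bm; exfalso.
  by move: ml; rewrite neq_ltn => /orP[lm|ml];
    [exact: (Bdisj _ _ _ lm lN Bm Bl) | exact: (Bdisj _ _ _ ml mN Bl Bm)].
- move=> l lN; rewrite uE.
  rewrite (eq_bigr (fun i => if B l i then `|w l i| else 0)); last first.
    by move=> i _; case: ifP => // _; exact: phaseM.
  rewrite ger0_norm; last by apply: sumr_ge0 => i _; case: ifP.
  have H : escape n lam J l <= \sum_(0 <= i < n.+1) (if B l i then `|w l i| else 0) +
      \sum_(0 <= i < n.+1) \sum_(l.+1 <= m < N) (if A m i then `|w l i| else 0).
    rewrite -big_split; apply: ler_sum => i _ /=.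
    rewrite -/(w l i) -if_neg -/(A l i) /B.
    have S0 : 0 <= \sum_(l.+1 <= m < N) (if A m i then `|w l i| else 0).
      by apply: sumr_ge0 => m _; case: ifP.
    case: (A l i) => /=; last by rewrite add0r.
    case: hasP => [[m mI Am]|_] /=; last by rewrite lerDl.
    rewrite add0r (bigD1_seq m) ?iota_uniq//= Am lerDl.
    by apply: sumr_ge0 => m' _; case: ifP.
  have := lt_le_trans (HJ l lN) H; rewrite exchange_big /= => /ltW H'.
  rewrite -(lerD2r (e / 2)) -splitr (le_trans H')// lerD2l.
  apply: (@le_trans _ _ (\sum_(l.+1 <= m < N) tau)).
    by apply: ler_sum_nat => m /andP[lm _]; exact: Asmall.
  rewrite sumr_const_nat -[tau *+ _]mulr_natl (le_trans _ Nt)// ler_pM2r// ler_nat.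
  exact: leq_subr.
- move=> l m lm mN; rewrite uE; apply: le_trans t_le; apply: le_trans (Asmall l m lm).
  apply: le_trans (ler_norm_sum _ _ _) _; apply: ler_sum => i _.
  rewrite /B; case: (A m i) => /=; last by rewrite normr0.
  by case: ifP; rewrite ?normr0// normrM ler_piMl// phase_le1.
Qed.

End fixed_operator.
End not_order_bounded.

(** * Almost biorthogonal systems *)

Section biorthogonal.
Local Open Scope ring_scope.
Variables (k : scalar_kind) (R : realType).
Local Notation K := (scalar_field k R).
Local Notation E := (l1sum_linfty k R).

Definition l1_head N : E -> E := l1_restrict (fun n => (n < N)%N).

(** Each of the finitely many coordinate functionals in the first [N] summands
    satisfies the summability estimate. *)
Lemma spread_head_small T (M eta : K) N D N0 (u : nat -> E) : linear T -> 0 < M ->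
  (forall x : E, `|T x| <= M * `|x|) -> spread N0 u -> 0 < eta ->
  \sum_(0 <= m < N) \sum_(0 <= i < m.+1) M <= eta * D%:R ->
  (count (fun l => ~~ (`|l1_head N (T (u l))| <= eta)%R) (iota 0 N0) <= D)%N.
Proof.
move=> linT M0 TM su eta0 HD; apply: count_large eta0 HD => [l|]; first exact: normr_ge0.
pose h m i x : K := (T x m : 'rV[K]_m.+1) ord0 (inord i).
apply: (@le_trans _ _
    (\sum_(0 <= l < N0) \sum_(0 <= m < N) \sum_(0 <= i < m.+1) `|h m i (u l)|)).
  apply: ler_sum => l _; apply: le_trans (l1_restrict_interval_le 0 N (T (u l))) _.
  apply: ler_sum => m _.
  have [i ->] := norm_rV_attained (T (u l) m : 'rV[K]_m.+1).
  rewrite (bigD1_seq (nat_of_ord i)) ?mem_index_iota ?iota_uniq ?ltn_ord//=.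
  by rewrite /h inord_val lerDl sumr_ge0.
rewrite exchange_big /=; apply: ler_sum => m _.
rewrite exchange_big /=; apply: ler_sum => i _.
apply: (spread_dual su) (ltW M0) => [a x y|x].
  by rewrite /h linT /= !mxE.
rewrite (le_trans _ (TM x))// (le_trans (norm_rV_coord _ _))//.
exact: (@l1sum_coord_le k R (fun m => 'rV[K]_m.+1) (T x) m).
Qed.

Lemma spread_subseq N0 (u : nat -> E) (t : seq nat) : spread N0 u -> uniq t ->
  (forall l, l \in t -> (l < N0)%N) -> spread (size t) (fun i => u (nth 0%N t i)).
Proof.
move=> su ut tN a a1.
pose a' l := if l \in t then a (index l t) else 0.
have a'1 l : `|a' l| <= 1 by rewrite /a'; case: ifP; rewrite ?normr0.
suff -> : \sum_(0 <= i < size t) a i *: u (nth 0%N t i) = \sum_(0 <= l < N0) a' l *: u l.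
  exact: su.
transitivity (\sum_(l <- t) a' l *: u l).
  rewrite [RHS](big_nth 0%N); apply: eq_big_nat => i /andP[_ it].
  by rewrite /a' mem_nth// index_uniq.
have tP : perm_eq t [seq l <- index_iota 0 N0 | l \in t].
  apply: uniq_perm => //; first by rewrite filter_uniq// iota_uniq.
  move=> l; rewrite mem_filter mem_index_iota /=.
  by case lt : (l \in t) => //=; rewrite tN.
rewrite (perm_big _ tP)/= big_filter big_mkcond; apply: eq_bigr => l _.
by rewrite /a'; case: (l \in t); rewrite ?scale0r.
Qed.

(** The matrix of the rows is small on one side of the diagonal by construction,
    and passing to a sparse subsequence makes it small on the other side. As a
    coordinate functional is large on few of the vectors only, those whose image
    has a large head can be discarded. *)
Lemma almost_biorthogonal T : bounded_op T -> ~ order_bounded T ->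
  exists2 c : K, 0 < c & forall L N (eta : K), 0 < eta ->
  exists (u : nat -> E) (f : nat -> E -> K),
  [/\ spread L u,
      forall i a x y, f i (a *: x + y) = a * f i x + f i y,
      forall i x, (i < L)%N -> `|f i x| <= c * `|x|,
      forall i j, (i < L)%N -> (j < L)%N -> `|f i (T (u j)) - (i == j)%:R| <= eta &
      forall j, (j < L)%N -> `|l1_head N (T (u j))| <= eta].
Proof.
move=> bT nob; have [linT _] := bT; have [M M0 TM] := bounded_opP bT.
have [rho rho0 Hrho] := disjoint_carriers linT M0 TM nob.
exists rho^-1; first by rewrite invr_gt0.
move=> L N eta eta0; pose d := eta * rho; have d0 : 0 < d by rewrite mulr_gt0.
have [|D1 HD1] := @scalar_archi k R (M / d); first by rewrite divr_ge0// ltW.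
pose S : K := \sum_(0 <= m < N) \sum_(0 <= i < m.+1) M.
have S0 : 0 <= S by apply: sumr_ge0 => m _; apply: sumr_ge0 => i _; exact: ltW.
have [|D2 HD2] := @scalar_archi k R (S / eta); first by rewrite divr_ge0// ltW.
(* Of the [N0] vectors at most [D2] are discarded because of their head, and each
   row is large on at most [D1] vectors. *)
pose N0 := (L * D1.+1 + D2)%N.
have [u [J [su uJ ud]]] := Hrho N0 d d0.
pose row j x := theta_coord (T x) j.
have row_linear j a x y : row j (a *: x + y) = a * row j x + row j y.
  by rewrite /row linT theta_coord_linear.
have row_le j x : `|row j x| <= M * `|x| by exact: le_trans (theta_coord_le _ _) (TM _).
pose bad l m := ~~ (`|row (J l) (u m)| <= d).
have bad_count l : (count (bad l) (iota 0 N0) <= D1)%N.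
  apply: (@count_large _ _ N0 (fun m => `|row (J l) (u m)|) M) => //.
    exact: (spread_dual su (row_linear _) (row_le _) (ltW M0)).
  by rewrite mulrC -ler_pdivrMr.
pose good l := (`|l1_head N (T (u l))| <= eta).
have good_count : (count (predC good) (iota 0 N0) <= D2)%N.
  by apply: (spread_head_small linT M0 TM su eta0); rewrite mulrC -ler_pdivrMr.
(* In decreasing order the selection takes care of the vectors that precede a row;
   on the vectors that follow it, a row is small anyway. *)
pose s := rev [seq l <- iota 0 N0 | good l].
have sN l : l \in s -> good l && (l < N0)%N.
  by rewrite mem_rev mem_filter mem_iota.
have [||t [ts tL tp]] := @sparse_subseq bad D1 L s.
- rewrite size_rev size_filter -(leq_add2r D2) -/N0.
  rewrite -{1}(size_iota 0 N0) -(count_predC good) leq_add2l.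
  exact: good_count.
- move=> l _; rewrite count_rev (leq_trans _ (bad_count l))//.
  exact: leq_count_subseq _ (filter_subseq _ _).
have us : uniq s by rewrite rev_uniq filter_uniq ?iota_uniq.
have ut : uniq t by exact: subseq_uniq us.
have tN l : l \in t -> good l && (l < N0)%N by move=> /(mem_subseq ts) /sN.
have tdec : pairwise gtn t.
  have gtn_trans : transitive gtn by move=> y x z /= yx zy; exact: ltn_trans zy yx.
  apply: (subseq_pairwise ts); rewrite -sorted_pairwise// rev_sorted.
  by apply: sorted_filter; [exact: ltn_trans | exact: iota_ltn_sorted].
have nt i : (i < L)%N -> nth 0%N t i \in t by move=> iL; rewrite mem_nth// tL.
pose v i := nth 0%N t i.
pose f i x := theta_coord x (J (v i)) / row (J (v i)) (u (v i)).
have rl i : (i < L)%N -> rho <= `|row (J (v i)) (u (v i))|.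
  by move=> /nt/tN/andP[_ iN]; exact: uJ.
exists (fun i => u (v i)), f; split.
- by rewrite -tL; apply: (spread_subseq su ut) => l /tN /andP[].
- by move=> i a x y; rewrite /f theta_coord_linear mulrDl mulrA.
- move=> i x iL; rewrite /f normrM normfV mulrC.
  by rewrite ler_pM ?invr_ge0 ?theta_coord_le// lef_pV2 ?posrE ?rl// (lt_le_trans rho0) ?rl.
- move=> i j iL jL; have ri0 := lt_le_trans rho0 (rl i iL).
  have [<-|ij] := eqVneq i j.
    by rewrite /f divff ?subrr ?normr0 ?(ltW eta0)// -normr_gt0.
  rewrite subr0 /f normrM normfV ler_pdivrMr//.
  apply: (@le_trans _ _ d); last by rewrite ler_pM2l// rl.
  move: ij; rewrite neq_ltn => /orP[ij|ji].
    have := (pairwiseP 0%N tp) i j; rewrite !inE tL iL jL => /(_ isT isT ij).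
    by rewrite negbK.
  have vji := (pairwiseP 0%N tdec) j i; rewrite !inE tL iL jL in vji.
  by apply: ud; [exact: vji | have /andP[] := tN _ (nt j jL)].
- by move=> j /nt/tN/andP[].
Qed.

End biorthogonal.

(** * The gliding hump *)

Lemma gluing_constant (F : numFieldType) (c d : F) :
  (c * d + (c * d + (1 + 2 * c) * d) = (1 + 4 * c) * d)%R.
Proof. by ring. Qed.

Section gluing.
Local Open Scope ring_scope.
Variables (k : scalar_kind) (R : realType).
Local Notation K := (scalar_field k R).
Local Notation E := (l1sum_linfty k R).
Local Notation Esingle n v := (@l1_single k R (fun n => 'rV[K]_n.+1) n v).

Lemma spread_le N (u : nat -> E) (a : nat -> K) (r : K) : spread N u -> 0 <= r ->
  (forall i, `|a i| <= r) -> `|\sum_(0 <= i < N) a i *: u i| <= r.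
Proof.
move=> su r0 ar; have [rE|rn0] := eqVneq r 0.
  rewrite big1 ?normr0// => i _; have := ar i.
  by rewrite rE normr_le0 => /eqP ->; rewrite scale0r.
have r_gt0 : 0 < r by rewrite lt0r rn0.
have -> : \sum_(0 <= i < N) a i *: u i = r *: \sum_(0 <= i < N) (r^-1 * a i) *: u i.
  by rewrite scaler_sumr; apply: eq_bigr => i _; rewrite scalerA mulrA divff// mul1r.
rewrite normrZ ger0_norm// ler_piMr//; apply: su => i.
by rewrite normrM normfV (ger0_norm r0) mulrC ler_pdivrMr// mul1r.
Qed.

Lemma sum_intervals (F : nat -> K) (N : nat -> nat) m : N 0%N = 0%N ->
  {homo N : i j / (i <= j)%N} ->
  \sum_(0 <= l < m) \sum_(N l <= n < N l.+1) F n = \sum_(0 <= n < N m) F n.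
Proof.
move=> N0 Nm; elim: m => [|m IH]; first by rewrite N0 !big_geq.
by rewrite big_nat_recr//= IH -big_cat_nat// Nm.
Qed.

Definition slice (N : nat -> nat) l : E -> E :=
  l1_restrict (fun n => (N l <= n < N l.+1)%N).

(** The norms of disjoint slices of a vector add up to at most its norm, so
    uniformly bounded maps on the slices combine to a bounded operator. *)
Lemma sliced_operator (N : nat -> nat) (f : nat -> nat -> E -> K) (c : K) :
  N 0%N = 0%N -> {homo N : i j / (i <= j)%N} -> 0 <= c ->
  (forall l i a x y, f l i (a *: x + y) = a * f l i x + f l i y) ->
  (forall l i x, (i < l.+1)%N -> `|f l i x| <= c * `|x|) ->
  exists A : E -> E, [/\ bounded_op A, forall x, `|A x| <= c * `|x| &
    forall l x, A (slice N l x) = Esingle l (\row_(i < l.+1) f l i (slice N l x))].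
Proof.
move=> N0 Nm c0 linf fc.
pose a x l : 'rV[K]_l.+1 := \row_(i < l.+1) f l i (slice N l x).
have ac x m : \sum_(0 <= l < m) `|a x l| <= c * `|x|.
  apply: (@le_trans _ _ (c * \sum_(0 <= n < N m) `|x n|)); last first.
    by rewrite ler_wpM2l// (l1sum_partial_le x).
  rewrite -(sum_intervals (fun n => `|x n|))// mulr_sumr; apply: ler_sum => l _.
  apply: norm_rV_le => [|i]; first by rewrite mulr_ge0// sumr_ge0.
  rewrite mxE (le_trans (fc _ _ _ _))// ler_wpM2l//.
  exact: l1_restrict_interval_le.
have aS x : @summable_seq k R (fun n => 'rV[K]_n.+1) (a x).
  by apply/summable_seqP; exists (c * `|x|) => m; exact: ac.
pose A x : E := L1sum (aS x).
have Ac x : `|A x| <= c * `|x| by apply: l1sum_le => m; exact: ac.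
exists A; split => //.
  split; last by exists c.
  move=> b x y; apply: l1sum_eq => l; apply/rowP => i.
  by rewrite !mxE /slice l1_restrict_linear linf.
move=> l x; apply: l1sum_eq => m; have [->|ml] := eqVneq m l.
  rewrite l1_single_same; apply/rowP => i; rewrite !mxE; congr f.
  by apply: l1sum_eq => n /=; case: (_ && _).
rewrite l1_single_other//; apply/rowP => i; rewrite !mxE.
have -> : slice N m (slice N l x) = 0.
  apply: l1sum_eq => n /=; case: ifP => // /andP[mn nm]; case: ifP => // /andP[ln nl].
  move: ml; rewrite neq_ltn => /orP[ml|lm].
    by have := leq_trans (leq_trans nm (Nm _ _ ml)) ln; rewrite ltnn.
  by have := leq_trans (leq_trans nl (Nm _ _ lm)) mn; rewrite ltnn.
have := linf m i (-1) 0 0; rewrite scaler0 addr0 mulN1r => ->.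
by rewrite addNr.
Qed.

Lemma slice_decomposition (N : nat -> nat) l (z : E) : (N l <= N l.+1)%N ->
  z = l1_head (N l) z + (slice N l z + l1_restrict (fun n => ~~ (n < N l.+1)%N) z).
Proof.
move=> Nl; apply: l1sum_eq => n /=; case: (ltnP n (N l)) => nl /=.
  by rewrite (leq_trans nl Nl) /= !addr0.
by case: (n < N l.+1)%N; rewrite /= ?addr0 ?add0r.
Qed.

(** The images of finitely many vectors are nearly supported in finitely many
    summands, which bounds the stage on the right as well. *)
Lemma gluing_stage T (c : K) : bounded_op T ->
  (forall L N (eta : K), 0 < eta -> exists (u : nat -> E) (f : nat -> E -> K),
  [/\ spread L u,
      forall i a x y, f i (a *: x + y) = a * f i x + f i y,
      forall i x, (i < L)%N -> `|f i x| <= c * `|x|,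
      forall i j, (i < L)%N -> (j < L)%N -> `|f i (T (u j)) - (i == j)%:R| <= eta &
      forall j, (j < L)%N -> `|l1_head N (T (u j))| <= eta]) ->
  forall L N (eta : K), 0 < eta -> exists p : nat * (nat -> E) * (nat -> E -> K),
  [/\ (N <= p.1.1)%N /\ spread L p.1.2,
      forall i a x y, p.2 i (a *: x + y) = a * p.2 i x + p.2 i y,
      forall i x, (i < L)%N -> `|p.2 i x| <= c * `|x|,
      forall i j, (i < L)%N -> (j < L)%N -> `|p.2 i (T (p.1.2 j)) - (i == j)%:R| <= eta &
      forall j, (j < L)%N -> `|l1_head N (T (p.1.2 j))| <= eta /\
        `|l1_restrict (fun n => ~~ (n < p.1.1)%N) (T (p.1.2 j))| <= eta].
Proof.
move=> bT H L N eta eta0; have [u [f [su linf fc fu hu]]] := H L N eta eta0.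
have [t tP] := choice (fun j => l1_tail_small (T (u j)) eta0).
exists (maxn N (\max_(j < L) t j), u, f); split => //=.
  by rewrite leq_maxl.
move=> j jL; split; first exact: hu.
apply: tP; rewrite leq_max; apply/orP; right.
exact: (@leq_bigmax _ (fun j : 'I_L => t j) (Ordinal jL)).
Qed.

(** The $l$-th stage provides a copy of $\ell^\infty(l+1)$ on which $T$ is almost
    inverted by uniformly bounded functionals. The image of this copy under $T$ is
    nearly supported in a group of summands that begins where the group of the
    preceding stage ends, so the stages hardly interact and the composite is a
    perturbation of the identity. *)
Lemma not_order_bounded_factor T : bounded_op T -> ~ order_bounded T ->
  exists A B : E -> E, [/\ bounded_op A, bounded_op B & A \o T \o B = idfun].
Proof.
move=> bT nob; have [linT _] := bT.
have [c c0 Hc] := almost_biorthogonal bT nob.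
(* The head, the tail and the entries of the middle part of the image of the $l$-th
   stage contribute errors that add up to $(1 + 4c)(l + 1)\eta_l$. *)
pose eta l : K := (2 * (1 + 4 * c) * l.+1%:R)^-1.
have c4 : 0 < 1 + 4 * c by rewrite ltr_wpDr// mulr_ge0// ltW.
have eta0 l : 0 < eta l by rewrite invr_gt0 !mulr_gt0.
have stage (lN : nat * nat) := gluing_stage bT Hc lN.1.+1 lN.2 (eta0 lN.1).
have [p pP] := choice stage.
pose N := fix N l := if l is l'.+1 then (p (l', N l')).1.1 else 0%N.
pose u l := (p (l, N l)).1.2; pose f l := (p (l, N l)).2.
have NS l : (N l <= N l.+1)%N by have [[]] := pP (l, N l).
have Nm : {homo N : i j / (i <= j)%N} by apply: homo_leq => //; exact: leq_trans.
have su l : spread l.+1 (u l) by have [[]] := pP (l, N l).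
have linf l i a x y : f l i (a *: x + y) = a * f l i x + f l i y.
  by have [_ h _ _ _] := pP (l, N l); exact: h.
have fc l i x : (i < l.+1)%N -> `|f l i x| <= c * `|x|.
  by have [_ _ h _ _] := pP (l, N l); exact: h.
have fu l i j : (i < l.+1)%N -> (j < l.+1)%N ->
    `|f l i (T (u l j)) - (i == j)%:R| <= eta l.
  by have [_ _ _ h _] := pP (l, N l); exact: h.
have hu l j : (j < l.+1)%N -> `|l1_head (N l) (T (u l j))| <= eta l /\
    `|l1_restrict (fun n => ~~ (n < N l.+1)%N) (T (u l j))| <= eta l.
  by have [_ _ _ _ h] := pP (l, N l); exact: h.
have [A [bA Ac AE]] := sliced_operator (erefl _) Nm (ltW c0) linf fc.
pose phi l (v : 'rV[K]_l.+1) : E := \sum_(0 <= j < l.+1) v ord0 (inord j) *: u l j.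
have linphi l : linear (phi l).
  move=> a x y; rewrite /phi scaler_sumr -big_split; apply: eq_bigr => j _ /=.
  by rewrite !mxE scalerDl scalerA.
have phi_le l v : `|phi l v| <= 1 * `|v|.
  by rewrite mul1r; apply: spread_le => // j; exact: norm_rV_coord.
have [B [bB _ BE]] := @l1sum_lift k R (fun n => 'rV[K]_n.+1) E phi 1 ler01 linphi phi_le.
have bW : bounded_op (A \o T \o B) by exact: bounded_comp (bounded_comp bA bT) bB.
have [linW _] := bW; have [linA _] := bA.
suff Wnear x : `|(A \o T \o B) x - x| <= 2^-1 * `|x|.
  have [V bV VE] := left_inverse_near_id linW Wnear.
  by exists (V \o A), B; split => //; exact: bounded_comp.
have bI : bounded_op (idfun : E -> E) by exact: bounded_id.
apply: (l1sum_op_le (bounded_sub bW bI)); first by rewrite invr_ge0.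
move=> l v; rewrite /= BE.
set z := T (phi l v).
have zE : z = \sum_(0 <= j < l.+1) (v : 'rV[K]_l.+1) ord0 (inord j) *: T (u l j).
  by rewrite /z /phi (lin_sum linT); apply: eq_bigr => j _; rewrite (linZ linT).
pose d := l.+1%:R * eta l * `|v|.
have sum_le (V : completeNormedModType K) (g : E -> V) : linear g ->
    (forall j, (j < l.+1)%N -> `|g (T (u l j))| <= eta l) -> `|g z| <= d.
  move=> ling gu; rewrite zE (lin_sum ling) (le_trans (ler_norm_sum _ _ _))//.
  apply: (@le_trans _ _ (\sum_(0 <= j < l.+1) (eta l * `|v|))); last first.
    by rewrite sumr_const_nat subn0 -[_ *+ l.+1]mulr_natl mulrA.
  apply: ler_sum_nat => j /andP[_ jl].
  by rewrite (linZ ling) normrZ mulrC ler_pM// ?gu// norm_rV_coord.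
have h1 : `|l1_head (N l) z| <= d.
  by apply: sum_le => [|j jl]; [exact: l1_restrict_linear | have [] := hu l j jl].
have h2 : `|l1_restrict (fun n => ~~ (n < N l.+1)%N) z| <= d.
  by apply: sum_le => [|j jl]; [exact: l1_restrict_linear | have [] := hu l j jl].
have d0 : 0 <= d by rewrite !mulr_ge0// ltW.
have h3 : `|A (slice N l z) - Esingle l v| <= (1 + 2 * c) * d.
  rewrite AE -(linB (@l1_single_linear _ _ (fun n => 'rV[K]_n.+1) l)).
  apply: le_trans (l1_single_le _) _.
  apply: norm_rV_le => [|i]; first by rewrite mulr_ge0// addr_ge0// mulr_ge0// ltW.
  rewrite !mxE.
  have linf' : linear (f l i : E -> K^o) by move=> a y1 y2; exact: linf.
  have fz : `|f l i z - v ord0 i| <= d.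
    rewrite zE (lin_sum linf').
    have -> : v ord0 i = \sum_(0 <= j < l.+1) v ord0 (inord j) * (nat_of_ord i == j)%:R.
      rewrite (bigD1_seq (nat_of_ord i)) ?mem_index_iota ?iota_uniq ?ltn_ord//=.
      rewrite eqxx mulr1 inord_val big1 ?addr0// => j ij.
      by rewrite eq_sym (negPf ij) mulr0.
    rewrite -sumrB (le_trans (ler_norm_sum _ _ _))//.
    apply: (@le_trans _ _ (\sum_(0 <= j < l.+1) (eta l * `|v|))); last first.
      by rewrite sumr_const_nat subn0 -[_ *+ l.+1]mulr_natl mulrA.
    apply: ler_sum_nat => j /andP[_ jl].
    by rewrite (linZ linf') -mulrBr normrM mulrC ler_pM// ?fu// norm_rV_coord.
  have -> : f l i (slice N l z) = f l i z - f l i (l1_head (N l) z) -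
      f l i (l1_restrict (fun n => ~~ (n < N l.+1)%N) z).
    rewrite -!(linB linf'); congr f.
    by rewrite {2}(slice_decomposition z (NS l)) (addrC (l1_head _ _)) !addrK.
  have fd y : `|y| <= d -> `|f l i y| <= c * d.
    by move=> yd; rewrite (le_trans (fc _ _ _ _))// ler_pM2l.
  rewrite -addrA -opprD [X in _ - X]addrC opprD addrA (addrAC (f l i z)).
  have -> : (1 + 2 * c) * d = d + c * d + c * d.
    by rewrite mulrDl mul1r -mulrA mulr_natl mulr2n addrA.
  rewrite (le_trans (ler_normB _ _))// lerD//; last exact: fd.
  by rewrite (le_trans (ler_normB _ _))// lerD//; exact: fd.
have -> : A z - Esingle l v = A (l1_head (N l) z) +
    (A (l1_restrict (fun n => ~~ (n < N l.+1)%N) z) + (A (slice N l z) - Esingle l v)).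
  rewrite {1}(slice_decomposition z (NS l)) !(linD linA) -!addrA; congr (_ + _).
  by rewrite addrCA.
have Ad y : `|y| <= d -> `|A y| <= c * d.
  by move=> yd; rewrite (le_trans (Ac y))// ler_pM2l.
rewrite (le_trans (ler_normD _ _))//.
rewrite (le_trans (lerD (Ad _ h1) (ler_normD _ _)))//.
rewrite (le_trans (lerD (lexx _) (lerD (Ad _ h2) h3)))//.
rewrite gluing_constant /d mulrA; apply: ler_wpM2r => //.
rewrite /eta mulrA -ler_pdivlMr ?invr_gt0 ?mulr_gt0// invrK.
by rewrite !mulrA mulVf ?mul1r.
Qed.

End gluing.

(** * The maximal ideal *)

Section maximal.
Variables (k : scalar_kind) (R : realType).
Local Notation E := (l1sum_linfty k R).

Definition id_factors (T : E -> E) := exists A B : E -> E,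
  [/\ bounded_op A, bounded_op B & A \o T \o B = idfun].

Lemma Gi_l1P (T : E -> E) : bounded_op T ->
  (Gi_l1 T <-> order_bounded T) /\ (Gi_l1 T <-> ~ id_factors T).
Proof.
move=> bT; have gi_nf : Gi_l1 T -> ~ id_factors T.
  by move=> giT [A [B [bA bB]]]; exact: Gi_not_factor_id giT bA bB.
have nf_ob : ~ id_factors T -> order_bounded T.
  by move=> nf; apply: contrapT => /(not_order_bounded_factor bT).
have ob_gi : order_bounded T -> Gi_l1 T by exact: order_bounded_Gi.
by split; split => [h|h]; [exact: nf_ob (gi_nf h)| exact: ob_gi | exact: gi_nf |
  exact: ob_gi (nf_ob h)].
Qed.

Lemma Gi_l1_ideal : Defs.ideal (@Gi_l1 k R E).
Proof.
have b0 : bounded_op ((fun=> 0%R) : E -> E).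
  split; first by move=> a u v; rewrite /= scaler0 addr0.
  by exists 0%R => x; rewrite normr0 mul0r.
split.
- by move=> T [].
- apply: ((Gi_l1P b0).1.2 _); exact: order_bounded0.
- move=> S T giS giT; have [[bS _] [bT _]] := (giS, giT).
  apply: ((Gi_l1P (bounded_add bS bT)).1.2 _); apply: order_bounded_add.
    exact: (Gi_l1P bS).1.1.
  exact: (Gi_l1P bT).1.1.
- move=> A T B bA giT bB; have [bT _] := giT.
  have bATB := bounded_comp (bounded_comp bA bT) bB.
  apply: ((Gi_l1P bATB).2.2 _) => -[A' [B' [bA' bB' id']]].
  apply: ((Gi_l1P bT).2.1 giT); exists (A' \o A), (B \o B').
  by split; [exact: bounded_comp | exact: bounded_comp | exact: id'].
Qed.

(** A proper ideal contains no operator through which the identity factors. *)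
Lemma proper_ideal_sub_Gi (J : set (E -> E)) : Defs.proper_ideal J -> J `<=` @Gi_l1 k R E.
Proof.
move=> [[Jb J0 JD JM] [_ nJ]] T JT.
apply: ((Gi_l1P (Jb _ JT)).2.2 _) => -[A [B [bA bB ATB]]]; apply: nJ => S bS.
have J1 : J idfun by rewrite -ATB; exact: JM.
by have := JM S idfun idfun bS J1 (bounded_id _).
Qed.

Lemma Gi_l1_proper : Defs.proper_ideal (@Gi_l1 k R E).
Proof.
split; first exact: Gi_l1_ideal.
split; first by move=> T [].
move=> /(_ idfun (bounded_id _)) gi1.
apply: ((Gi_l1P (bounded_id _)).2.1 gi1).
by exists idfun, idfun; split => //; exact: bounded_id.
Qed.

End maximal.

Unset Implicit Arguments.

Theorem theorem8 (k : scalar_kind) (R : realType) :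
  (forall T : l1sum_linfty k R -> l1sum_linfty k R,
     bounded_op T -> ~ Gi_l1 T ->
     exists A B : l1sum_linfty k R -> l1sum_linfty k R,
       [/\ bounded_op A, bounded_op B & A \o T \o B = idfun]) /\
  (maximal_ideal (@Gi_l1 k R (l1sum_linfty k R)) /\
   forall J : set (l1sum_linfty k R -> l1sum_linfty k R),
     maximal_ideal J -> J = @Gi_l1 k R (l1sum_linfty k R)).
Proof.
split=> [T bT ngi|].
  by apply: contrapT => nf; apply: ngi; apply: ((Gi_l1P bT).2.2 _).
split.
  split=> [|J pJ giJ]; first exact: Gi_l1_proper.
  by apply/seteqP; split => //; exact: proper_ideal_sub_Gi.
move=> J [pJ Jmax]; apply/esym/Jmax; first exact: Gi_l1_proper.
exact: proper_ideal_sub_Gi.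
Qed.
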